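(* Let $X$ be a Riemann surface obtained from a decorated equilateral triangulation and let $f:X\to 2\Delta$ be the associated Belyi function, $d=\deg f$. Label the edges of the dessin of $f$ by $a_1,\dots,a_d$, and let $p_i\in f^{-1}(1/2)$ be the midpoint of $a_i$. Let $\omega_0=m+n\omega$ with $m,n\in\mathbb{Z}$ relatively prime and $n$ odd, let $\ell(t)=\frac12+t\omega_0$, and let $\gamma(t)=\pi(\ell(t))$, $t\in[0,T]$, be the corresponding closed geodesic in $2\Delta$ based at $1/2$, where $T=1$ if $\omega_0\in Hex$ and $T=3$ if $\omega_0\notin Hex$. Fix $i$, let $\tau_i$ be the cycle containing $i$ in the cycle decomposition of the permutation $\sigma_\gamma\in \mathrm{Sym}(f^{-1}(1/2))\cong S_d$, and let $r=\operatorname{ord}\tau_i$ be the length of this cycle. Then the development $\tilde\gamma=\Psi\circ\ell$ of $\ell$ in $X$ based at $p_i$, taken over the parameter interval $[0,rT]$, can be expressed (up to reparametrization) as the concatenation of paths $$\tilde{\gamma}=\tilde{\gamma}_{p_i}\cdot\tilde{\gamma}_{\sigma_\gamma(p_i)}\cdots\tilde{\gamma}_{\sigma_\gamma^{r-1}(p_i)} .$$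
   Context: Let $\omega=\exp(2\pi i/6)$, $\Lambda_{1,\omega}=\mathbb{Z}+\mathbb{Z}\omega$. $\Delta$ is the Euclidean equilateral triangle with vertices $0,1,\omega$, decorated $\circ,\bullet,\ast$ respectively; $2\Delta$ is the sphere obtained by gluing $\Delta$ and its complex conjugate $\bar\Delta$ along their boundaries via $z\mapsto\bar z$, with its flat conic metric and induced complex structure. $\Gamma_{3,3,3}$ is the group generated by the rotations of angle $2\pi/3$ about $0,1,\omega$; $2\Delta=\mathbb{C}/\Gamma_{3,3,3}$ with projection $\pi:\mathbb{C}\to2\Delta$. The tessellation of $\mathbb{C}$ by unit equilateral triangles with vertices $\Lambda_{1,\omega}$ is decorated $\Gamma_{3,3,3}$-invariantly; $Hex=\langle 2-\omega,1+\omega\rangle$ is the sub-lattice of vertices decorated $\circ$. A decorated equilateral triangulation of a compact connected oriented surface $X$ is a triangulation by Euclidean equilateral triangles of the same size, glued along edges by isometries (two triangles may share more than one edge), whose vertices are decorated by $\circ,\bullet,\ast$ so that adjacent vertices have different decorations; it induces a conic flat metric and a Riemann surface structure on $X$. Lengths are normalized so that edges have length one. A triangle is black if the ordered triple $(\circ,\bullet,\ast)$ of its vertices is positively oriented and white otherwise. The associated Belyi function $f:X\to2\Delta$ sends each triangle of $X$ isometrically onto the triangle of $2\Delta$ of the same color, preserving decorations. The edges of the dessin of $f$ are the edges of the triangulation joining $\circ$ to $\bullet$ (the components of the preimage of the edge $[0,1]$), so $f^{-1}(1/2)$ is the set of their midpoints. For a loop $\gamma$ in $2\Delta\setminus\{0,1,\omega\}$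 based at $1/2$ and $x\in f^{-1}(1/2)$, $\tilde\gamma_{x}$ denotes the lift of $\gamma$ by $f$ starting at $x$, and $\sigma_\gamma$ is the permutation of $f^{-1}(1/2)$ sending $x$ to the endpoint of $\tilde\gamma_x$. If a line $\ell$ through $1/2$ contains no point of $\Lambda_{1,\omega}$, let $P$ be the union of the triangles of the tessellation meeting $\ell$. The development of $\ell$ in $X$ with respect to (based at) $p\in f^{-1}(1/2)$ is the unique continuous map $\Psi:P\to X$ with $\Psi(1/2)=p$ that maps triangles isometrically onto triangles, preserving decorations; the curve $\Psi\circ\ell$ is also called the development of $\ell$. Concatenations are read from left to right. *)

(* Defs.v *)
From HB Require Import structures.
From Stdlib Require Import Relation_Operators.
From mathcomp Require Import all_boot all_order all_algebra all_fingroup.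
From mathcomp Require Import generic_quotient.
From mathcomp Require Import complex ring lra.
From mathcomp Require Import all_classical all_reals all_analysis.

Set Implicit Arguments.
Unset Strict Implicit.
Unset Printing Implicit Defensive.
Import Order.TTheory GRing.Theory Num.Theory numFieldNormedType.Exports.

Local Open Scope classical_set_scope.
Local Open Scope ring_scope.
Local Open Scope complex_scope.

HB.instance Definition _ (R : realType) := NormedModule.copy R[i] R[i]^o.

(** * Decorated triangles in the plane *)

Variant deco := Circ | Bullet | Ast.

Definition triple (A : Type) (x y z : A) (k : 'I_3) : A := nth x [:: x; y; z] k.

Record ptriangle (R : realType) := PTriangle {
  vtx : 'I_3 -> R[i];
  vdeco : 'I_3 -> deco }.

Section Plane.
Variable R : realType.
Implicit Types (Q : ptriangle R) (z w : R[i]).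

(* [ordS] is the cyclic successor on ['I_3]; side [k] of a triangle runs from
   vertex [k] to vertex [ordS k]. *)
Definition side_pt Q (k : 'I_3) (s : R) : R[i] :=
  (1 - s)%:C * vtx Q k + s%:C * vtx Q (ordS k).

Definition region Q : set R[i] :=
  [set z | exists c : 'I_3 -> R,
     [/\ forall k, 0 <= c k, \sum_k c k = 1 & z = \sum_k (c k)%:C * vtx Q k]].

Definition unit_equilateral Q :=
  forall j k : 'I_3, j != k -> `|vtx Q j - vtx Q k| = 1.

Definition positively_oriented (a b c : R[i]) : Prop :=
  0 < complex.Im ((b - a)^* * (c - a)).

Definition black Q : Prop :=
  exists j0 j1 j2 : 'I_3,
    [/\ vdeco Q j0 = Circ, vdeco Q j1 = Bullet, vdeco Q j2 = Ast
      & positively_oriented (vtx Q j0) (vtx Q j1) (vtx Q j2)].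

(* Preserving both the decorations and the colour is what makes the isometry
   orientation preserving. *)
Definition deco_isometry Q Q' (g : R[i] -> R[i]) : Prop :=
  [/\ forall z w, region Q z -> region Q w -> `|g z - g w| = `|z - w|,
      g @` region Q = region Q',
      forall j k, vdeco Q j = vdeco Q' k -> g (vtx Q j) = vtx Q' k
    & black Q <-> black Q'].

Lemma region_vtx0 Q : vtx Q ord0 \in region Q.
Proof.
rewrite inE; exists (fun k => (k == ord0)%:R); split.
- by move=> k; rewrite ler0n.
- by rewrite (bigD1 ord0) //= big1 ?addr0 // => k /negbTE ->.
- rewrite (bigD1 ord0) //= big1 ?addr0 ?mul1r // => k /negbTE ->.
  by rewrite mul0r.
Qed.

End Plane.

(** * Decorated equilateral triangulations and the surfaces they define *)

(* The faces are plane triangles with vertices numbered counterclockwise.  Side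
   [e] is glued to side [opp e] by the orientation reversing isometry, so the
   orientations of the faces fit together; every side being glued to exactly one
   other one, the quotient is a compact oriented surface without boundary.  The
   decoration lives on the vertices of the quotient: this is [vdeco_opp]. *)
Record decorated_triangulation (R : realType) := DecoratedTriangulation {
  face : finType;
  tri : face -> ptriangle R;
  tri_unit : forall t, unit_equilateral (tri t);
  tri_ccw : forall t, positively_oriented (vtx (tri t) ord0)
    (vtx (tri t) (ordS ord0)) (vtx (tri t) (ordS (ordS ord0)));
  opp : face * 'I_3 -> face * 'I_3;
  oppK : involutive opp;
  opp_neq : forall e, opp e != e;
  vdeco_opp : forall e,
    vdeco (tri e.1) e.2 = vdeco (tri (opp e).1) (ordS (opp e).2);
  vdeco_adj : forall t k, vdeco (tri t) k <> vdeco (tri t) (ordS k) }.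

Section Surface.
Variables (R : realType) (X : decorated_triangulation R).

Definition faces_sum : Type := {t : face X & set_type (region (tri t))}.

Definition face_pt (t : face X) (z : R[i]) : faces_sum :=
  existT _ t (insubd (SigSub (region_vtx0 (tri t))) z).

Definition glue_sides (x y : faces_sum) : Prop :=
  exists (e : face X * 'I_3) (s : R),
    [/\ 0 <= s <= 1,
        x = face_pt e.1 (side_pt (tri e.1) e.2 s)
      & y = face_pt (opp e).1 (side_pt (tri (opp e).1) (opp e).2 (1 - s))].

Definition glued : rel faces_sum :=
  fun x y => `[< clos_refl_sym_trans faces_sum glue_sides x y >].

Lemma glued_refl : reflexive glued.
Proof. by move=> x; apply/asboolP/rst_refl. Qed.

Lemma glued_sym : symmetric glued.
Proof. by move=> x y; apply/asboolP/asboolP => h; apply: rst_sym. Qed.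

Lemma glued_trans : transitive glued.
Proof. by move=> y x z /asboolP xy /asboolP yz; apply/asboolP/rst_trans/yz. Qed.

Canonical glued_equiv := EquivRel glued glued_refl glued_sym glued_trans.

Definition surface : Type :=
  quotient_topology {eq_quot glued_equiv}%qT.

(* Meaningful for [z] in [region (tri t)] only. *)
Definition chart (t : face X) (z : R[i]) : surface :=
  (\pi_(quotient_topology {eq_quot glued_equiv}) (face_pt t z))%qT.

End Surface.

Arguments chart {R} X t z.

(** * The double triangle, and its presentation as an orbit space *)

Section DoubleTriangle.
Variable R : realType.

(* exp(2 i pi / 6) *)
Definition omega : R[i] := cos (2 * pi / 6) +i* sin (2 * pi / 6).

Definition Delta : ptriangle R := PTriangle (triple 0 1 omega) (triple Circ Bullet Ast).

(* The complex conjugate of [Delta], listed counterclockwise. *)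
Definition Delta_bar : ptriangle R :=
  PTriangle (triple 0 omega^* 1) (triple Circ Ast Bullet).

Definition double_tri (b : bool) : ptriangle R := if b then Delta else Delta_bar.

(* With the counterclockwise numberings, complex conjugation exchanges sides
   [k] and [2 - k] of the two triangles. *)
Definition double_opp (e : bool * 'I_3) : bool * 'I_3 := (~~ e.1, rev_ord e.2).

Lemma cos_third : cos (2 * pi / 6) = 1 / 2 :> R.
Proof.
set x : R := 2 * pi / 6.
have h3 : cos (x + x + x) = -1 by rewrite -cospi; congr cos; rewrite /x; field.
have c0 : 0 < cos x.
  by apply: cos_gt0_pihalf; rewrite /x; have := pi_gt0 R; lra.
move: h3; rewrite !cosD !sinD => h3.
have h2 := cos2Dsin2 x.
have : (cos x + 1) * (2 * cos x - 1) ^+ 2 = 0.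
  have -> : sin x ^+ 2 = 1 - cos x ^+ 2 -> (cos x + 1) * (2 * cos x - 1) ^+ 2 =
    (cos x * cos x - sin x * sin x) * cos x -
    (sin x * cos x + cos x * sin x) * sin x + 1 by move=> e; ring: e.
    by rewrite h3; ring.
  by rewrite -h2; ring.
move/eqP; rewrite mulf_eq0 sqrf_eq0 => /orP[] /eqP; lra.
Qed.

Lemma sin_third_sq : sin (2 * pi / 6) ^+ 2 = 3 / 4 :> R.
Proof. by rewrite sin2cos2 cos_third; field. Qed.

Lemma sin_third_gt0 : 0 < sin (2 * pi / 6) :> R.
Proof. by apply: sin_gt0_pi; have := pi_gt0 R; lra. Qed.

Lemma double_tri_unit b : unit_equilateral (double_tri b).
Proof.
have n1 (x y : R) : x ^+ 2 + y ^+ 2 = 1 -> `|x +i* y| = 1.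
  by move=> e; rewrite normc_def /= e sqrtr1.
have s2 := sin_third_sq.
by case: b; case=> [[|[|[|//]]] ?]; case=> [[|[|[|//]]] ?] //= _;
  rewrite /triple /= ?/omega ?cos_third; simpc; apply: n1; nra.
Qed.

Lemma double_tri_ccw b : positively_oriented (vtx (double_tri b) ord0)
  (vtx (double_tri b) (ordS ord0)) (vtx (double_tri b) (ordS (ordS ord0))).
Proof.
have s0 := sin_third_gt0.
by case: b; rewrite /positively_oriented /triple /= /omega /=; nra.
Qed.

Lemma double_oppK : involutive double_opp.
Proof. by case=> b k; rewrite /double_opp /= negbK rev_ordK. Qed.

Lemma double_opp_neq e : double_opp e != e.
Proof. by case: e => -[] k. Qed.

Lemma double_vdeco_opp e : vdeco (double_tri e.1) e.2 =
  vdeco (double_tri (double_opp e).1) (ordS (double_opp e).2).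
Proof. by case: e => -[] [[|[|[|//]]] ?]. Qed.

Lemma double_vdeco_adj b k :
  vdeco (double_tri b) k <> vdeco (double_tri b) (ordS k).
Proof. by case: b; case: k => [[|[|[|//]]] ?]. Qed.

Definition double_triangle : decorated_triangulation R :=
  DecoratedTriangulation double_tri_unit double_tri_ccw double_oppK
    double_opp_neq double_vdeco_opp double_vdeco_adj.

Definition rotation (c z : R[i]) : R[i] := c + omega ^+ 2 * (z - c).

Inductive Gamma333 : (R[i] -> R[i]) -> Prop :=
| Gamma333_id : Gamma333 id
| Gamma333_rot k : Gamma333 (rotation (vtx Delta k))
| Gamma333_comp g h : Gamma333 g -> Gamma333 h -> Gamma333 (g \o h)
| Gamma333_inv g h :
    Gamma333 g -> cancel g h -> cancel h g -> Gamma333 h.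

Definition orbit_projection (q : R[i] -> surface double_triangle) : Prop :=
  [/\ forall z, region Delta z -> q z = chart double_triangle true z,
      forall z, region Delta_bar z -> q z = chart double_triangle false z
    & forall z w, q z = q w <-> exists2 g, Gamma333 g & w = g z].

(** ** The decorated tessellation of the plane *)

Definition Lambda : set R[i] :=
  [set z | exists a b : int, z = a%:~R + b%:~R * omega].

Definition Hex : set R[i] :=
  [set z | exists a b : int, z = a%:~R * (2 - omega) + b%:~R * (1 + omega)].

Definition tile (Q : ptriangle R) : Prop :=
  [/\ forall k, Lambda (vtx Q k), unit_equilateral Q
    & forall k, exists2 g, Gamma333 g &
        exists2 j, vtx Q k = g (vtx Delta j) & vdeco Q k = vdeco Delta j].

Definition line (w : R[i]) (t : R) : R[i] := 1 / 2 + t%:C * w.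

Definition meets_line (w : R[i]) (Q : ptriangle R) : Prop :=
  exists t, region Q (line w t).

Definition strip (w : R[i]) : set R[i] :=
  [set z | exists Q, [/\ tile Q, meets_line w Q & region Q z]].

Definition line_period (w : R[i]) : R := if `[< Hex w >] then 1 else 3.

End DoubleTriangle.

(** * Paths and lifts *)

Section Paths.
Variables (R : realType) (S : topologicalType).

(* A path parametrized by [0, plen]; [pfun] is irrelevant elsewhere. *)
Record path_on := PathOn { plen : R; pfun : R -> S }.

Definition path_cat (a b : path_on) : path_on :=
  PathOn (plen a + plen b)
    (fun t => if t <= plen a then pfun a t else pfun b (t - plen a)).

(* [a 0 . a 1 ... a r.-1], for [0 < r]. *)
Definition path_concat (a : nat -> path_on) (r : nat) : path_on :=
  foldl path_cat (a 0%N) [seq a k | k <- iota 1 r.-1].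

Definition reparametrization (a b : path_on) : Prop :=
  exists phi : R -> R,
    [/\ {within `[0, plen a], continuous phi},
        {in `[0, plen a] &, {homo phi : s t / s < t}},
        phi 0 = 0, phi (plen a) = plen b
      & {in `[0, plen a], forall t, pfun a t = pfun b (phi t)}].

End Paths.

Section Lifts.
Variables (R : realType) (S S' : topologicalType) (f : S -> S').

Definition is_lift (c : R -> S') (T : R) (x : S) (u : R -> S) : Prop :=
  [/\ {within `[0, T], continuous u}, u 0 = x
    & {in `[0, T], forall t, f (u t) = c t}].

(* Outside [0, T] the chosen lift is arbitrary.  If there is no lift, the value
   is the constant path. *)
Definition lift_from (c : R -> S') (T : R) (x : S) : path_on R S :=
  PathOn T (xget (fun=> x) [set u | is_lift c T x u]).

Definition monodromy (c : R -> S') (T : R) (x : S) : S :=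
  pfun (lift_from c T x) T.

End Lifts.

(** * Belyi function, dessin, development *)

Section Belyi.
Variables (R : realType) (X : decorated_triangulation R).

Definition maps_onto_triangle (Q : ptriangle R) (F : R[i] -> surface X) :=
  exists t g, deco_isometry Q (tri t) g /\
    forall z, region Q z -> F z = chart X t (g z).

Definition development (w : R[i]) (p : surface X) (Psi : R[i] -> surface X) :=
  [/\ {within strip w, continuous Psi}, Psi (1 / 2) = p
    & forall Q, tile Q -> meets_line w Q -> maps_onto_triangle Q Psi].

Definition edge (t : face X) (k : 'I_3) : set (surface X) :=
  [set chart X t (side_pt (tri t) k s) | s in `[0, 1]].

Definition midpoint (t : face X) (k : 'I_3) : surface X :=
  chart X t (side_pt (tri t) k (1 / 2)).

Definition joins_circ_bullet (t : face X) (k : 'I_3) : Prop :=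
  (vdeco (tri t) k = Circ /\ vdeco (tri t) (ordS k) = Bullet) \/
  (vdeco (tri t) k = Bullet /\ vdeco (tri t) (ordS k) = Circ).

Definition dessin_edges : set (set (surface X)) :=
  [set A | exists t k, joins_circ_bullet t k /\ A = edge t k].

Definition dessin_labelling (d : nat)
    (a : 'I_d -> set (surface X)) (p : 'I_d -> surface X) : Prop :=
  [/\ injective a, range a = dessin_edges
    & forall i, exists t k,
        [/\ joins_circ_bullet t k, a i = edge t k & p i = midpoint t k]].

End Belyi.

Section BelyiFunction.
Variables (R : realType) (X : decorated_triangulation R).
Variable f : surface X -> surface (double_triangle R).

Definition belyi_function : Prop :=
  forall t : face X, maps_onto_triangle (tri t) (f \o chart X t).

(* The degree as the cardinality of the fibres away from the three vertices. *)
Definition has_degree (d : nat) : Prop :=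
  forall y, (forall k, y <> chart (double_triangle R) true (vtx (Delta R) k)) ->
    (f @^-1` [set y] #= `I_d)%card.

End BelyiFunction.

(* Main.v *)
From Stdlib Require Import Relation_Operators.
From mathcomp Require Import all_boot all_order all_algebra all_fingroup.
From mathcomp Require Import generic_quotient.
From mathcomp Require Import complex ring lra zify.
From mathcomp Require Import all_classical all_reals all_analysis.
Require Import Defs.
Import Order.TTheory GRing.Theory Num.Theory numFieldNormedType.Exports.
Set Implicit Arguments.
Unset Strict Implicit.
Unset Printing Implicit Defensive.
Local Open Scope classical_set_scope.
Local Open Scope ring_scope.
Local Open Scope complex_scope.

(* On a tile, [f \o Psi] and [q] are both the colour and decoration preserving
   isometry onto a face of the double triangle, so [f \o Psi = q] along the line:
   the development is a lift of [gamma].  The vector [T * omega0] lies in [Hex],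
   hence [gamma] has period [T], and each restriction of the development to
   [[k T, (k + 1) T]] is, after translation, a lift of [gamma] over [[0, T]].
   Since [n] is odd the line avoids the vertices, and lifts that avoid the
   vertices are unique: off the vertices the surface is covered by open diamonds
   (two faces glued along one side), on which [f] is injective, and two diamonds
   for sides with the same decorations are equal or disjoint; so the coincidence
   set of two lifts is clopen.  The reparametrization is therefore the identity. *)

(** * Indices and decorations of the three corners *)

Lemma ord3_cases (P : 'I_3 -> Prop) :
  P ord0 -> P (ordS ord0) -> P (ordS (ordS ord0)) -> forall k, P k.
Proof.
move=> h0 h1 h2 [[|[|[|//]]] hk].
- by rewrite (_ : Ordinal _ = ord0) //; apply/val_inj.
- by rewrite (_ : Ordinal _ = ordS ord0) //; apply/val_inj.
- by rewrite (_ : Ordinal _ = ordS (ordS ord0)) //; apply/val_inj.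
Qed.

(** Starting the sum at an arbitrary corner [k] lets one computation serve all three corners. *)
Lemma sum_ord3 (V : nmodType) (F : 'I_3 -> V) k :
  \sum_j F j = F k + F (ordS k) + F (ordS (ordS k)).
Proof.
have e0 : \sum_j F j = F ord0 + F (ordS ord0) + F (ordS (ordS ord0)).
  rewrite !big_ord_recl big_ord0 addr0 addrA.
  by congr (F _ + F _ + F _); apply/val_inj.
have s3 : ordS (ordS (ordS ord0)) = ord0 :> 'I_3 by apply/val_inj.
elim/ord3_cases: k; rewrite e0 // !s3.
  by rewrite [RHS]addrC addrA.
by rewrite [LHS]addrC addrA.
Qed.

Lemma deco_surj (v : 'I_3 -> deco) : injective v -> forall x, exists k, v k = x.
Proof.
move=> vi x.
have n01 : v ord0 <> v (ordS ord0) by move/vi/(congr1 val).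
have n02 : v ord0 <> v (ordS (ordS ord0)) by move/vi/(congr1 val).
have n12 : v (ordS ord0) <> v (ordS (ordS ord0)) by move/vi/(congr1 val).
case e0 : (v ord0) n01 n02 => n01 n02; case e1 : (v (ordS ord0)) n01 n12 => n01 n12;
 case e2 : (v (ordS (ordS ord0))) n02 n12 => n02 n12; case: x => //;
 solve [by exists ord0 | by exists (ordS ord0) | by exists (ordS (ordS ord0))].
Qed.

Lemma vdeco_matching (R : realType) (Q Q' : ptriangle R) :
  injective (vdeco Q) -> injective (vdeco Q') ->
  exists2 s : 'I_3 -> 'I_3, injective s & forall j, vdeco Q j = vdeco Q' (s j).
Proof.
move=> i1 i2.
have /choice[s sE] j : exists k, vdeco Q j = vdeco Q' k.
  by have [k <-] := deco_surj i2 (vdeco Q j); exists k.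
exists s => // j k e; apply: i1.
by rewrite !sE e.
Qed.

(** * Barycentric coordinates in equilateral triangles *)

Section Barycentric.
Variable R : realType.
Implicit Types (Q : ptriangle R) (z w : R[i]).

Definition nsq z : R := complex.Re z ^+ 2 + complex.Im z ^+ 2.

Lemma normE z : `|z| = (Num.sqrt (nsq z))%:C.
Proof. by case: z. Qed.

Lemma nsq_ge0 z : 0 <= nsq z.
Proof. by rewrite addr_ge0 ?sqr_ge0. Qed.

Lemma norm_nsq z w : `|z| = `|w| -> nsq z = nsq w.
Proof.
rewrite !normE => -[e].
by rewrite -(sqr_sqrtr (nsq_ge0 z)) e sqr_sqrtr ?nsq_ge0.
Qed.

Lemma norm1_nsq z : `|z| = 1 <-> nsq z = 1.
Proof.
split=> [e|e]; last by rewrite normE e sqrtr1.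
have /norm_nsq -> : `|z| = `|1 : R[i]| by rewrite e normr1.
by rewrite /nsq /=; ring.
Qed.

(* In an equilateral triangle the squared distances to the vertices differ by
   the differences of the barycentric coordinates; this form of the coordinates
   is visibly invariant under isometries. *)
Definition bary Q (k : 'I_3) z : R :=
  (1 + \sum_j (nsq (z - vtx Q j) - nsq (z - vtx Q k))) / 3.

Lemma baryE Q k z : bary Q k z = (1 + nsq (z - vtx Q (ordS k)) +
  nsq (z - vtx Q (ordS (ordS k))) - 2 * nsq (z - vtx Q k)) / 3.
Proof. by rewrite /bary (sum_ord3 _ k); ring. Qed.

Lemma ordS3 (k : 'I_3) : ordS (ordS (ordS k)) = k.
Proof. by elim/ord3_cases: k; apply/val_inj. Qed.

Lemma ordS_neq (k : 'I_3) : ordS k != k.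
Proof. by elim/ord3_cases: k. Qed.

Lemma ordSS_neq (k : 'I_3) : ordS (ordS k) != k.
Proof. by elim/ord3_cases: k. Qed.

Lemma bary_sum Q z : \sum_k bary Q k z = 1.
Proof. by rewrite (sum_ord3 _ ord0) !baryE !ordS3; field. Qed.

Lemma unit_nsq Q j k : unit_equilateral Q -> j != k ->
  nsq (vtx Q j - vtx Q k) = 1.
Proof. by move=> u jk; apply/norm1_nsq/u. Qed.

Lemma bary_convex Q (c : 'I_3 -> R) k : unit_equilateral Q -> \sum_j c j = 1 ->
  bary Q k (\sum_j (c j)%:C * vtx Q j) = c k.
Proof.
move=> u; rewrite (sum_ord3 c k) baryE (sum_ord3 _ k).
have := unit_nsq u (ordS_neq k); have := unit_nsq u (ordSS_neq k).
have := unit_nsq u (ordS_neq (ordS k)).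
move: (c k) (c (ordS k)) (c (ordS (ordS k))) => a b d.
case: (vtx Q k) (vtx Q (ordS k)) (vtx Q (ordS (ordS k))) => [x y] [x' y'] [x2 y2].
rewrite /nsq /= => e1 e2 e3 sm.
have -> : a = 1 - b - d by rewrite -sm; ring.
(* The two edges at corner [k] are unit vectors with inner product 1/2, the latter because the third
   side also has length 1. *)
have comb (s t : R) : (s * (x' - x) + t * (x2 - x)) ^+ 2 +
    (s * (y' - y) + t * (y2 - y)) ^+ 2 = s ^+ 2 + t ^+ 2 + s * t.
  have -> : s * t = s * t * (((x' - x) ^+ 2 + (y' - y) ^+ 2) +
    ((x2 - x) ^+ 2 + (y2 - y) ^+ 2) - ((x2 - x') ^+ 2 + (y2 - y') ^+ 2)).
    by rewrite e1 e2 e3; ring.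
  have -> : s ^+ 2 = s ^+ 2 * ((x' - x) ^+ 2 + (y' - y) ^+ 2) by rewrite e3 mulr1.
  have -> : t ^+ 2 = t ^+ 2 * ((x2 - x) ^+ 2 + (y2 - y) ^+ 2) by rewrite e2 mulr1.
  by ring.
(* These give the squared distances [A], [B], [C] from the point to the corners [k], [ordS (ordS k)]
   and [ordS k]. *)
have := comb (b - 1) d; have := comb b (d - 1); have := comb b d.
set A := (X in X = _ -> _) => eA; set B := (X in X = _ -> _) => eB.
set C := (X in X = _ -> _) => eC.
transitivity ((1 + C + B - 2 * A) / 3); last by rewrite eA eB eC; field.
by rewrite /A /B /C; field.
Qed.

Lemma region_bary Q z : unit_equilateral Q -> region Q z ->
  [/\ forall k, 0 <= bary Q k z & z = \sum_k (bary Q k z)%:C * vtx Q k].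
Proof.
move=> u [c [c0 c1 ->]]; split=> [k|]; first by rewrite bary_convex.
by apply: eq_bigr => k _; rewrite bary_convex.
Qed.

Lemma side_pt_convex Q k (s : R) :
  side_pt Q k s = \sum_j (if j == k then 1 - s else
    if j == ordS k then s else 0)%:C * vtx Q j.
Proof.
rewrite (sum_ord3 _ k) eqxx (negbTE (ordS_neq _)) eqxx (negbTE (ordSS_neq _)).
by rewrite (negbTE (ordS_neq _)) mul0r addr0.
Qed.

Lemma side_sum (k : 'I_3) (s : R) : \sum_j (if j == k then 1 - s else
    if j == ordS k then s else 0) = 1.
Proof.
rewrite (sum_ord3 _ k) eqxx (negbTE (ordS_neq _)) eqxx (negbTE (ordSS_neq _)).
by rewrite (negbTE (ordS_neq _)) addr0 subrK.
Qed.

Lemma bary_side Q j k (s : R) : unit_equilateral Q ->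
  bary Q j (side_pt Q k s) = if j == k then 1 - s else if j == ordS k then s else 0.
Proof. by move=> u; rewrite side_pt_convex bary_convex // side_sum. Qed.

Lemma region_side Q k (s : R) : 0 <= s <= 1 -> region Q (side_pt Q k s).
Proof.
move=> /andP[s0 s1]; exists (fun j => if j == k then 1 - s else
    if j == ordS k then s else 0); split; rewrite ?side_sum ?side_pt_convex //.
by move=> j; case: ifP => _; [rewrite subr_ge0|case: ifP].
Qed.

Lemma side_pt_bary Q k z : unit_equilateral Q -> region Q z ->
  bary Q (ordS (ordS k)) z = 0 -> z = side_pt Q k (bary Q (ordS k) z).
Proof.
move=> u /(region_bary u)[_ zE] b0; have := bary_sum Q z.
rewrite (sum_ord3 _ k) b0 addr0 => bs.
by rewrite {1}zE (sum_ord3 _ k) b0 mul0r addr0 /side_pt -bs addrK.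
Qed.

Lemma region_vtx Q k : region Q (vtx Q k).
Proof.
have -> : vtx Q k = side_pt Q k 0 by rewrite /side_pt subr0 mul1r mul0r addr0.
by apply: region_side; rewrite lexx ler01.
Qed.

Lemma bary_eq1 Q k z : unit_equilateral Q -> region Q z ->
  bary Q (ordS k) z = 0 -> bary Q (ordS (ordS k)) z = 0 -> z = vtx Q k.
Proof.
move=> u rz b1 b2; rewrite (side_pt_bary u rz b2) b1.
by rewrite /side_pt subr0 mul1r mul0r addr0.
Qed.

Lemma bary_eq_region Q z w : unit_equilateral Q -> region Q z -> region Q w ->
  (forall k, bary Q k z = bary Q k w) -> z = w.
Proof.
move=> u /(region_bary u)[_ {2}->] /(region_bary u)[_ {2}->] e.
by apply: eq_bigr => k _; rewrite e.
Qed.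

(* Distances determine barycentric coordinates, so isometries need not be known
   to be affine. *)
Lemma bary_isometry Q Q' (s : 'I_3 -> 'I_3) z w : injective s ->
  (forall k, `|z - vtx Q k| = `|w - vtx Q' (s k)|) ->
  forall k, bary Q k z = bary Q' (s k) w.
Proof.
move=> si e k; rewrite /bary [in RHS](reindex_inj si) /=.
congr ((1 + _) / 3); apply: eq_bigr => j _.
by rewrite !(norm_nsq (e _)).
Qed.

Lemma deco_isometry_bary Q Q' (g : R[i] -> R[i]) z j k :
  injective (vdeco Q) -> injective (vdeco Q') ->
  deco_isometry Q Q' g -> region Q z -> vdeco Q j = vdeco Q' k ->
  bary Q j z = bary Q' k (g z).
Proof.
move=> i1 i2 [giso _ gv _] rz jk.
have [s si sE] := vdeco_matching i1 i2.
have -> : k = s j by apply: i2; rewrite -jk sE.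
apply: bary_isometry => // l.
by rewrite -(gv l (s l) (sE l)) giso //; apply: region_vtx.
Qed.

End Barycentric.

(** * Continuity of coordinates and of lines in the plane *)

#[local] Instance complex_nbhs_filter (R : realType) (z : R[i]) :
  ProperFilter (nbhs z) := nbhs_pfilter z.

Section PlaneTopology.
Variable R : realType.

Lemma continuous_lipschitz1 (h : R[i] -> R) :
  (forall z w, `|h z - h w|%:C <= `|z - w|) -> continuous h.
Proof.
move=> hl z; apply/cvgrPdist_lt => e e0.
have ec : 0 < e%:C :> R[i] by rewrite ltcR.
apply/nbhs_ballP; exists e%:C => //= w zw.
by rewrite -ltcR; exact: le_lt_trans (hl _ _) zw.
Qed.

Lemma continuous_Re : continuous (@complex.Re R).
Proof.
apply: continuous_lipschitz1 => z w.
by rewrite -raddfB; exact: normc_ge_Re.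
Qed.

Lemma continuous_Im : continuous (@complex.Im R).
Proof.
apply: continuous_lipschitz1 => -[a b] [c d] /=.
rewrite normE /nsq /= lecR -sqrtr_sqr.
by rewrite ler_wsqrtr // lerDr sqr_ge0.
Qed.

Lemma continuous_nsq (c : R[i]) : continuous (fun z : R[i] => nsq (z - c)).
Proof.
have -> : (fun z : R[i] => nsq (z - c)) = fun z =>
    (complex.Re z - complex.Re c) * (complex.Re z - complex.Re c) +
    (complex.Im z - complex.Im c) * (complex.Im z - complex.Im c).
  by apply/funext => -[x y]; case: c => *; rewrite /nsq !expr2.
have cRe := continuous_Re; have cIm := continuous_Im.
move=> z; apply: cvgD.
  by apply: cvgM; apply: cvgB; first [exact: cvg_cst|exact: cRe].
by apply: cvgM; apply: cvgB; first [exact: cvg_cst|exact: cIm].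
Qed.

Lemma continuous_bary (Q : ptriangle R) k : continuous (bary Q k).
Proof.
rewrite (funext (baryE Q k)) => z; apply: cvgM; last exact: cvg_cst.
apply: cvgB; last by apply: cvgM; [exact: cvg_cst|exact: continuous_nsq].
apply: cvgD; last exact: continuous_nsq.
by apply: cvgD; [exact: cvg_cst|exact: continuous_nsq].
Qed.

Lemma continuous_line (w : R[i]) : continuous (line w).
Proof.
move=> t; apply: cvgD; first exact: cvg_cst.
apply: cvgM; last exact: cvg_cst.
apply/cvgrPdist_lt => e e0.
(* The norm of [R[i]] takes values in [R[i]]; the radius [e], being positive, is real. *)
have eE : e = (complex.Re e)%:C.
  by rewrite RRe_real // ger0_real // ltW.
have e0' : 0 < complex.Re e by rewrite -ltcR -eE.
apply/nbhs_ballP; exists (complex.Re e) => //= s ts.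
rewrite -rmorphB /= normc_def /=.
by rewrite expr0n /= addr0 sqrtr_sqr eE ltcR.
Qed.
End PlaneTopology.

(** * Corners, orientation and colour *)

Definition corner (R : realType) (Q : ptriangle R) (d : deco) : 'I_3 :=
  xget ord0 [set k | vdeco Q k = d].

(** By [deco_surj] the set in [corner] is nonempty, so [xget] picks one of its elements. *)
Lemma vdeco_corner (R : realType) (Q : ptriangle R) d : injective (vdeco Q) ->
  vdeco Q (corner Q d) = d.
Proof.
move=> qi; have [k kd] := deco_surj qi d.
exact: (@xgetI _ ord0 [set k | vdeco Q k = d] k).
Qed.

Lemma corner_vdeco (R : realType) (Q : ptriangle R) k : injective (vdeco Q) ->
  corner Q (vdeco Q k) = k.
Proof. by move=> qi; apply: (qi); rewrite vdeco_corner. Qed.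

(** The counterclockwise order of the decorations around a black triangle. *)
Definition next_deco (d : deco) : deco :=
  match d with Circ => Bullet | Bullet => Ast | Ast => Circ end.

Lemma ordSP (j k : 'I_3) : [\/ k = j, k = ordS j | k = ordS (ordS j)].
Proof.
by elim/ord3_cases: j; elim/ord3_cases: k; rewrite ?ordS3;
  solve [by constructor 1 | by constructor 2 | by constructor 3].
Qed.

Lemma positively_oriented_rot (R : realType) (a b c : R[i]) :
  positively_oriented b c a <-> positively_oriented a b c.
Proof.
case: a b c => [x y] [x1 y1] [x2 y2]; rewrite /positively_oriented /=.
by split=> h; [move: h|move: h]; congr (is_true (0 < _)); ring.
Qed.

Lemma positively_oriented_swap (R : realType) (a b c : R[i]) :
  positively_oriented a b c -> ~ positively_oriented a c b.
Proof.
case: a b c => [x y] [x1 y1] [x2 y2]; rewrite /positively_oriented /= => h.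
by apply/negP; rewrite -leNgt; lra.
Qed.

Definition ccw (R : realType) (Q : ptriangle R) := positively_oriented
  (vtx Q ord0) (vtx Q (ordS ord0)) (vtx Q (ordS (ordS ord0))).

Lemma ccw_rot (R : realType) (Q : ptriangle R) k : ccw Q ->
  positively_oriented (vtx Q k) (vtx Q (ordS k)) (vtx Q (ordS (ordS k))).
Proof.
move=> o; elim/ord3_cases: k => //; rewrite !ordS3.
  exact/positively_oriented_rot.
exact/positively_oriented_rot/positively_oriented_rot.
Qed.

(** The numbering is counterclockwise, so the colour only records whether the decorations run in the
    same sense as the indices; any single side [k] shows this. *)
Lemma black_next (R : realType) (Q : ptriangle R) k :
  injective (vdeco Q) -> ccw Q ->
  black Q <-> vdeco Q (ordS k) = next_deco (vdeco Q k).
Proof.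
move=> qi o; split=> [[j0 [j1 [j2 [e0 e1 e2 p]]]]|].
  have n01 : j1 <> j0 by move=> h; move: e1; rewrite h e0.
  have n02 : j2 <> j0 by move=> h; move: e2; rewrite h e0.
  have n12 : j2 <> j1 by move=> h; move: e2; rewrite h e1.
  have [h|h1|h1] := ordSP j0 j1; first by case: n01.
    have h2 : j2 = ordS (ordS j0).
      by have [h|h|] := ordSP j0 j2 => //; case: n12; rewrite h1.
    by have [->|->|->] := ordSP j0 k; rewrite ?ordS3 -?h2 -?h1 ?e0 ?e1 ?e2.
  have h2 : j2 = ordS j0.
    by have [h|h|h] := ordSP j0 j2 => //; case: n12; rewrite h1.
  case: (positively_oriented_swap p); rewrite h1 h2; exact: ccw_rot.
move=> e1.
have e2 : vdeco Q (ordS (ordS k)) = next_deco (next_deco (vdeco Q k)).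
  have n0 : vdeco Q (ordS (ordS k)) <> vdeco Q k.
    by move/qi/eqP; rewrite (negbTE (ordSS_neq _)).
  have : vdeco Q (ordS (ordS k)) <> vdeco Q (ordS k).
    by move/qi/eqP; rewrite (negbTE (ordS_neq _)).
  move: n0; rewrite e1.
  by case: (vdeco Q k); case: (vdeco Q (ordS (ordS k))).
case e0 : (vdeco Q k) e1 e2 => /= e1 e2.
- exists k, (ordS k), (ordS (ordS k)); split=> //; exact: ccw_rot.
- exists (ordS (ordS k)), k, (ordS k); split=> //.
  by apply: (proj1 (positively_oriented_rot _ _ _)); exact: ccw_rot.
- exists (ordS k), (ordS (ordS k)), k; split=> //.
  by apply: (proj2 (positively_oriented_rot _ _ _)); exact: ccw_rot.
Qed.

(** * Functions on the glued surface *)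

Section SurfaceFunctions.
Variables (R : realType) (X : decorated_triangulation R).
Implicit Types (F : face X -> R[i] -> R) (t : face X) (d : deco).

Lemma vdeco_inj t : injective (vdeco (tri t)).
Proof.
move=> j k; have := @vdeco_adj _ X t j; have := @vdeco_adj _ X t k.
by have [->|->|->] := ordSP j k => //; rewrite ordS3 => n1 n2 e; case: n1.
Qed.

Definition compatible F := forall (e : face X * 'I_3) (s : R), 0 <= s <= 1 ->
  F e.1 (side_pt (tri e.1) e.2 s) =
  F (opp e).1 (side_pt (tri (opp e).1) (opp e).2 (1 - s)).

(** Evaluates at the representative chosen by [repr]; for [compatible] families the value does not
    depend on that choice, by [descend_glued]. *)
Definition descend F (x : surface X) : R :=
  F (tag (repr x)) (val (tagged (repr x))).

Lemma val_face_pt t z : region (tri t) z -> val (tagged (face_pt t z)) = z.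
Proof. by move=> rz; rewrite /= insubdK // inE. Qed.

Lemma descend_glued F (x y : faces_sum X) : compatible F -> glued x y ->
  F (tag x) (val (tagged x)) = F (tag y) (val (tagged y)).
Proof.
move=> Fc /asboolP.
elim=> {x y} [x y [e [s [s01 -> ->]]]|//|x y _ ->//|x y z _ -> _ -> //].
have s01' : 0 <= 1 - s <= 1 by case/andP: s01 => *; apply/andP; split; lra.
by rewrite !val_face_pt /=; [exact: Fc|exact: region_side..].
Qed.

Lemma descend_chart F t z : compatible F -> region (tri t) z ->
  descend F (chart X t z) = F t z.
Proof.
move=> Fc rz; rewrite /descend -[in RHS](val_face_pt rz).
apply: (descend_glued (x := repr _) (y := face_pt t z) Fc).
by apply/eqmodP; rewrite reprK.
Qed.

(** The surface is a quotient of a disjoint sum, so continuity is checked on each face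
    separately. *)
Lemma descend_continuous F : compatible F -> (forall t, continuous (F t)) ->
  continuous (descend F).
Proof.
move=> Fc Fcont.
apply: (repr_comp_continuous (g := fun x : faces_sum X => F (tag x) (val (tagged x)))).
  apply: (@sigT_continuous _ _ _
    (fun t (z : set_type (region (tri t))) => F t (val z))).
  move=> t; apply/continuousP => A oA; exists (F t @^-1` A) => //.
  by move/continuousP: (Fcont t); apply.
by move=> x y /eqP/eqmodP xy; apply/eqP; apply: descend_glued.
Qed.

Lemma chart_surj (x : surface X) : exists t z, region (tri t) z /\ x = chart X t z.
Proof.
exists (tag (repr x)), (val (tagged (repr x))); split.
  by have := valP (tagged (repr x)); rewrite inE.
rewrite /chart -[LHS]reprK; congr (\pi _)%qT.
by case: (repr x) => t z; rewrite /face_pt /= valKd.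
Qed.

Lemma chart_glue (e : face X * 'I_3) (s : R) : 0 <= s <= 1 ->
  chart X e.1 (side_pt (tri e.1) e.2 s) =
  chart X (opp e).1 (side_pt (tri (opp e).1) (opp e).2 (1 - s)).
Proof. by move=> s01; apply/eqmodP/asboolP/rst_step; exists e, s. Qed.

End SurfaceFunctions.

(** * Kinds of sides, colours and diamonds *)

Section Diamonds.
Variables (R : realType) (X : decorated_triangulation R).
Implicit Types (e : face X * 'I_3) (t : face X) (d : deco) (z : R[i]).

Lemma vdeco_oppS e :
  vdeco (tri e.1) (ordS e.2) = vdeco (tri (opp e).1) (opp e).2.
Proof. by have := vdeco_opp (opp e); rewrite oppK. Qed.

(** The decoration of the opposite corner determines the pair of decorations at the ends of the
    side; unlike the index [e.2] it is preserved by [opp]. *)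
Definition kind e : deco := vdeco (tri e.1) (ordS (ordS e.2)).

Lemma kind_opp e : kind (opp e) = kind e.
Proof.
have n (e' : face X * 'I_3) :
    [/\ vdeco (tri e'.1) e'.2 <> vdeco (tri e'.1) (ordS e'.2),
      kind e' <> vdeco (tri e'.1) e'.2 & kind e' <> vdeco (tri e'.1) (ordS e'.2)].
  split=> [||] /vdeco_inj/eqP; rewrite ?(negbTE (ordSS_neq _)) //.
    by rewrite eq_sym (negbTE (ordS_neq _)).
  by rewrite (negbTE (ordS_neq _)).
have [] := n e; have [] := n (opp e); rewrite -vdeco_oppS -vdeco_opp.
move: (kind e) (kind (opp e)) (vdeco _ _) (vdeco _ _).
by do 4 case.
Qed.

(** Side [k] faces corner [ordS (ordS k)], so the side facing a corner [c] is [ordS c]. *)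
Definition side_of t d : 'I_3 := ordS (corner (tri t) d).

Definition mate d t : face X := (opp (t, side_of t d)).1.

Lemma side_of_kind e : side_of e.1 (kind e) = e.2.
Proof. by rewrite /side_of corner_vdeco ?ordS3 //; exact: vdeco_inj. Qed.

Lemma kind_side_of t d : kind (t, side_of t d) = d.
Proof. by rewrite /kind /= ordS3 vdeco_corner //; exact: vdeco_inj. Qed.

Lemma opp_side_of t d : opp (t, side_of t d) = (mate d t, side_of (mate d t) d).
Proof.
rewrite [LHS]surjective_pairing /mate; congr (_, _).
by rewrite -[LHS]side_of_kind kind_opp kind_side_of.
Qed.

Lemma mate_kind e : mate (kind e) e.1 = (opp e).1.
Proof. by rewrite /mate side_of_kind -surjective_pairing. Qed.

Lemma mateK d : involutive (mate d).
Proof.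
by move=> t; rewrite [in LHS]/mate -opp_side_of oppK.
Qed.

(** Indexing the coordinates by decorations makes them agree on glued sides, hence functions on the
    surface. *)
Definition deco_bary d t z : R := bary (tri t) (corner (tri t) d) z.

Lemma deco_bary_vdeco t k z : deco_bary (vdeco (tri t) k) t z = bary (tri t) k z.
Proof. by rewrite /deco_bary corner_vdeco //; exact: vdeco_inj. Qed.

Lemma deco_baryP t z w : region (tri t) z -> region (tri t) w ->
  (forall d, deco_bary d t z = deco_bary d t w) -> z = w.
Proof.
move=> rz rw e; apply: (bary_eq_region _ rz rw) => [|k]; first exact: tri_unit.
by rewrite -!deco_bary_vdeco e.
Qed.

Lemma deco_bary_compatible d : compatible (deco_bary d).
Proof.
move=> e s _.
have [k kd] := deco_surj (@vdeco_inj _ _ e.1) d.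
have [k' k'd] := deco_surj (@vdeco_inj _ _ (opp e).1) d.
rewrite -{1}kd -k'd !deco_bary_vdeco !bary_side; try exact: tri_unit.
(* Comparing decorations instead of indices relates the corners of two different faces. *)
have eqs (a b : 'I_3) (t : face X) :
    (a == b) = `[< vdeco (tri t) a = vdeco (tri t) b >].
  by apply/eqP/asboolP => [->|/vdeco_inj].
rewrite !(eqs k _ e.1) !(eqs k' _ (opp e).1) k'd kd -vdeco_oppS -vdeco_opp.
case: asboolP => h1; case: asboolP => h2 //; last by rewrite opprB addrC subrK.
by move: h2; rewrite h1 => /vdeco_inj/eqP; rewrite eq_sym (negbTE (ordS_neq _)).
Qed.

Definition colour t : R := if `[< black (tri t) >] then 1 else -1.

(** Neighbouring faces traverse their common side in opposite directions, so by [black_next] exactly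
    one of them is black. *)
Lemma colour_mate d t : colour (mate d t) = - colour t.
Proof.
have cw t' : ccw (tri t') by exact: tri_ccw.
have /= o1 := @vdeco_oppS (t, side_of t d).
have /= o2 := @vdeco_opp _ X (t, side_of t d).
rewrite opp_side_of /= in o1 o2; rewrite /colour.
have h1 := black_next (side_of t d) (@vdeco_inj _ _ t) (cw _).
have h2 := black_next (side_of (mate d t) d) (@vdeco_inj _ _ (mate d t)) (cw _).
rewrite -o1 -o2 in h2; rewrite (asbool_equiv_eq h1) (asbool_equiv_eq h2).
have : vdeco (tri t) (side_of t d) <> vdeco (tri t) (ordS (side_of t d)).
  exact: vdeco_adj.
move: (vdeco _ _) (vdeco _ _) => a b ab.
by case: asboolP => p; case: asboolP => q; rewrite ?opprK //; case: a b ab p q => [] [].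
Qed.

(* Vanishes on the sides; its sign inside a face tells the colour. *)
Definition signed_product t z : R :=
  colour t * (deco_bary Circ t z * deco_bary Bullet t z * deco_bary Ast t z).

Lemma deco_bary_prod t k z :
  deco_bary Circ t z * deco_bary Bullet t z * deco_bary Ast t z =
  bary (tri t) k z * bary (tri t) (ordS k) z * bary (tri t) (ordS (ordS k)) z.
Proof.
rewrite -!deco_bary_vdeco.
have := vdeco_adj (t := t) (k := k); have := vdeco_adj (t := t) (k := ordS k).
have := vdeco_adj (t := t) (k := ordS (ordS k)); rewrite ordS3.
move: (vdeco _ k) (vdeco _ (ordS k)) (vdeco _ (ordS (ordS k))).
by do 3 case => //; move=> *; ring.
Qed.

Lemma signed_product_side e (s : R) :
  signed_product e.1 (side_pt (tri e.1) e.2 s) = 0.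
Proof.
rewrite /signed_product (deco_bary_prod _ e.2) (@bary_side _ _ (ordS (ordS e.2))).
  by rewrite (negbTE (ordSS_neq _)) (negbTE (ordS_neq _)) !mulr0.
exact: tri_unit.
Qed.

Lemma signed_product_compatible : compatible signed_product.
Proof. by move=> e s _; rewrite !signed_product_side. Qed.

(* Supported on the interior of the union of [t0] and its neighbour across the
   side opposite to the corner decorated [d]. *)
Definition diamond d t0 t z : R := if (t == t0) || (t == mate d t0) then
  bary (tri t) (side_of t d) z * bary (tri t) (ordS (side_of t d)) z else 0.

Lemma mate_mem d t0 t : (mate d t == t0) || (mate d t == mate d t0) =
  (t == t0) || (t == mate d t0).
Proof.
rewrite orbC (inj_eq (can_inj (mateK d))); congr (_ || _).
by rewrite -(inj_eq (can_inj (mateK d))) mateK.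
Qed.

(** On a side of another kind the corner decorated [d] is an endpoint, and one factor vanishes. On a
    side of kind [d] the two faces are both in the diamond or both outside, and the value inside is
    the symmetric [s * (1 - s)]. *)
Lemma diamond_compatible d t0 : compatible (diamond d t0).
Proof.
have zero e s : kind e <> d -> diamond d t0 e.1 (side_pt (tri e.1) e.2 s) = 0.
  move=> kd; rewrite /diamond; case: ifP => // _.
  have n : corner (tri e.1) d <> ordS (ordS e.2).
    by move=> h; apply: kd; rewrite /kind -h vdeco_corner //; exact: vdeco_inj.
  rewrite /side_of !bary_side; try exact: tri_unit.
  have [h|h|//] := ordSP e.2 (corner (tri e.1) d); rewrite h.
    by rewrite !(negbTE (ordSS_neq _)) !(negbTE (ordS_neq _)) mulr0.
  by rewrite !(negbTE (ordSS_neq _)) !(negbTE (ordS_neq _)) mul0r.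
move=> e s _; have [kd|kd] := pselect (kind e = d); last first.
  by rewrite !zero ?kind_opp.
rewrite /diamond -kd -(mate_kind e) mate_mem; case: ifP => // _.
rewrite (mate_kind e) (side_of_kind e) -(kind_opp e) (side_of_kind (opp e)).
rewrite !bary_side; try exact: tri_unit.
by rewrite !eqxx !(negbTE (ordS_neq _)); ring.
Qed.

Lemma continuous_diamond d t0 t : continuous (diamond d t0 t).
Proof.
rewrite /diamond => z; case: ((t == t0) || _); last exact: cst_continuous.
by apply: cvgM; exact: continuous_bary.
Qed.

Definition in_diamond d t0 (x : surface X) : Prop := 0 < descend (diamond d t0) x.

Lemma open_in_diamond d t0 : open (in_diamond d t0).
Proof.
have /continuousP c :=
  descend_continuous (@diamond_compatible d t0) (@continuous_diamond d t0).
have -> : in_diamond d t0 = descend (diamond d t0) @^-1` [set r | 0 < r] by [].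
apply: c; exact: open_gt.
Qed.

Lemma in_diamondP d t0 (x : surface X) : in_diamond d t0 x <-> exists t z,
  [/\ region (tri t) z, x = chart X t z, (t == t0) || (t == mate d t0),
    0 < bary (tri t) (side_of t d) z & 0 < bary (tri t) (ordS (side_of t d)) z].
Proof.
have [t [z [rz ->]]] := chart_surj x; rewrite /in_diamond.
have [b0 _] := region_bary (tri_unit t) rz.
split.
  rewrite descend_chart //; last exact: diamond_compatible.
  rewrite /diamond; case: ifP => [tm|_]; last by rewrite ltxx.
  move=> p; exists t, z; split=> //.
    rewrite lt_neqAle; rewrite b0 andbT.
    by apply/eqP => h; move: p; rewrite -h mul0r ltxx.
  rewrite lt_neqAle; rewrite b0 andbT.
  by apply/eqP => h; move: p; rewrite -h mulr0 ltxx.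
move=> [t' [z' [rz' -> tm p1 p2]]].
rewrite descend_chart //; last exact: diamond_compatible.
by rewrite /diamond tm mulr_gt0.
Qed.

End Diamonds.

(* [x] is the image of the point [z] of [Q] under a colour and decoration
   preserving isometry of [Q] onto a face. *)
Definition represents (R : realType) (Y : decorated_triangulation R)
    (Q : ptriangle R) (z : R[i]) (x : surface Y) : Prop :=
  exists t w, [/\ region (tri t) w, x = chart Y t w,
    forall j k, vdeco Q j = vdeco (tri t) k -> bary Q j z = bary (tri t) k w
    & black Q <-> black (tri t)].

Lemma maps_onto_represents (R : realType) (Y : decorated_triangulation R)
    (Q : ptriangle R) (F : R[i] -> surface Y) z : injective (vdeco Q) ->
  maps_onto_triangle Q F -> region Q z -> represents Q z (F z).
Proof.
move=> qi [t [g [gi FE]]] rz; have [_ gim _ gb] := gi.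
exists t, (g z); split=> //.
- by rewrite -gim; exists z.
- exact: FE.
- by move=> j k; apply: deco_isometry_bary => //; exact: vdeco_inj.
Qed.

(** * Points of the double triangle *)

Section DoubleTriangle.
Variable R : realType.
Notation D := (double_triangle R).

Lemma black_double b : black (double_tri R b) <-> b.
Proof.
have di : injective (vdeco (double_tri R b)) := @vdeco_inj R D b.
have := black_next ord0 di (double_tri_ccw R b).
by case: b {di} => -> //=; split.
Qed.

(** The double triangle has one face of each colour: the colour determines the face, and the
    coordinates determine the point in it. *)
Lemma represents_inj (Q : ptriangle R) z (x y : surface D) : injective (vdeco Q) ->
  represents Q z x -> represents Q z y -> x = y.
Proof.
move=> qi [b [w [rw -> bw cw]]] [b' [w' [rw' -> bw' cw']]].
have eb : b = b'.
  have : black (double_tri R b) <-> black (double_tri R b').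
    by rewrite -[X in X <-> _]cw.
  rewrite !black_double; case: b {rw bw cw} => -[h1 h2]; first by rewrite h1.
  by case: b' {rw' bw' cw'} h1 h2 => // _ /(_ isT).
rewrite -eb in rw' bw' *; congr (chart _ _ _).
apply: (bary_eq_region (double_tri_unit R b)) => // k.
have [j jk] := deco_surj qi (vdeco (@tri R D b) k).
by rewrite -(bw _ _ jk) -(bw' _ _ jk).
Qed.

End DoubleTriangle.

(** * Fibres and lifts of the Belyi function *)

Section BelyiLifts.
Variables (R : realType) (X : decorated_triangulation R).
Variable f : surface X -> surface (double_triangle R).
Hypothesis hf : belyi_function f.

Lemma belyi_represents t z : region (tri t) z ->
  represents (tri t) z (f (chart X t z)).
Proof.
move=> rz; apply: (maps_onto_represents (F := f \o chart X t)) => //.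
exact: vdeco_inj.
Qed.

Lemma belyi_deco_bary d x : descend (deco_bary d) (f x) = descend (deco_bary d) x.
Proof.
have [t [z [rz ->]]] := chart_surj x.
have [b [w [rw -> bw _]]] := belyi_represents rz.
rewrite !descend_chart //; try exact: deco_bary_compatible.
by rewrite /deco_bary; apply/esym/bw; rewrite !vdeco_corner //; exact: vdeco_inj.
Qed.

Lemma belyi_signed_product x :
  descend (@signed_product _ _) (f x) = descend (@signed_product _ _) x.
Proof.
have [t [z [rz ->]]] := chart_surj x.
have [b [w [rw -> bw cw]]] := belyi_represents rz.
rewrite !descend_chart //; try exact: signed_product_compatible.
have bb d : deco_bary d b w = deco_bary d t z.
  by rewrite /deco_bary; apply/esym/bw; rewrite !vdeco_corner //; exact: vdeco_inj.
by rewrite /signed_product !bb /colour (asbool_equiv_eq cw).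
Qed.

(** Equal images have equal coordinates and signed products. Within one face the coordinates decide.
    Two mates have opposite colours, so the common product vanishes; two of its factors are
    positive, so the third is zero and both points lie on the common side, where [chart_glue]
    identifies them. *)
Lemma diamond_inj d t0 x y : in_diamond d t0 x -> in_diamond d t0 y ->
  f x = f y -> x = y.
Proof.
move=> /in_diamondP[t [z [rz -> tm z1 z2]]].
move=> /in_diamondP[t' [z' [rz' -> tm' z1' z2']]] fxy.
have bb d' : deco_bary d' t z = deco_bary d' t' z'.
  have := belyi_deco_bary d' (chart X t z); rewrite fxy belyi_deco_bary.
  by rewrite !descend_chart //; exact: deco_bary_compatible.
have ss : signed_product t z = signed_product t' z'.
  have := belyi_signed_product (chart X t z); rewrite fxy belyi_signed_product.
  by rewrite !descend_chart //; exact: signed_product_compatible.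
have [tt'|tt'] := eqVneq t t'.
  by rewrite -tt' in rz' bb *; congr chart; exact: (deco_baryP rz rz').
have {tm tm'} t'E : t' = mate d t.
  move: tm tm' tt' => /orP[]/eqP -> /orP[]/eqP -> //; rewrite ?eqxx // => _.
  by rewrite mateK.
rewrite t'E in rz' bb ss z1' z2' *.
have [b0 b0'] : bary (tri t) (ordS (ordS (side_of t d))) z = 0 /\
    bary (tri (mate d t)) (ordS (ordS (side_of (mate d t) d))) z' = 0.
  have bbE : bary (tri t) (ordS (ordS (side_of t d))) z =
      bary (tri (mate d t)) (ordS (ordS (side_of (mate d t) d))) z'.
    have := bb d; rewrite /deco_bary /side_of !ordS3; exact.
  suff b0 : bary (tri t) (ordS (ordS (side_of t d))) z = 0 by rewrite -bbE.
  apply/eqP.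
  move/eqP: ss; rewrite /signed_product colour_mate !bb -subr_eq0 mulNr opprK -mulr2n.
  rewrite mulrn_eq0 /= mulf_eq0 => /orP[].
    by rewrite /colour; case: asboolP => _; rewrite ?oppr_eq0 oner_eq0.
  rewrite -!bb (deco_bary_prod _ (side_of t d)) mulf_eq0 => /orP[|//].
  by rewrite mulf_eq0 (gt_eqF z1) (gt_eqF z2).
rewrite (side_pt_bary (tri_unit t) rz b0) [in RHS](side_pt_bary (tri_unit _) rz' b0').
set s := bary _ _ z.
have s1 : 1 - s = bary (tri t) (side_of t d) z.
  by rewrite -(bary_sum (tri t) z) (sum_ord3 _ (side_of t d)) b0 addr0 addrK.
have := @chart_glue _ X (t, side_of t d) s; rewrite opp_side_of /= => -> //.
  congr (chart _ _ (side_pt _ _ _)); rewrite s1 -!deco_bary_vdeco bb.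
  by have := @vdeco_opp _ X (t, side_of t d); rewrite opp_side_of /= => ->.
by rewrite (ltW z2) -subr_ge0 s1 ltW.
Qed.

(** The face carrying [x] belongs to both pairs of mates, and since [mate d] is an involution the
    pairs coincide. *)
Lemma in_diamond_label d a b (x : surface X) : in_diamond d a x -> in_diamond d b x ->
  (b == a) || (b == mate d a).
Proof.
have [t [z [rz ->]]] := chart_surj x; rewrite /in_diamond.
rewrite !descend_chart //; try exact: diamond_compatible.
rewrite /diamond; case: ifP => [ta _|]; last by rewrite ltxx.
case: ifP => [tb _|]; last by rewrite ltxx.
move: ta tb => /orP[]/eqP -> /orP[]/eqP h; apply/orP.
- by left; rewrite h.
- by right; rewrite h mateK.
- by right; rewrite h.
- by left; rewrite (can_inj (mateK d) h).
Qed.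

Lemma in_diamond_mate d (a b : face X) : (b == a) || (b == mate d a) ->
  in_diamond d b = in_diamond (X := X) d a.
Proof.
move=> ba; rewrite /in_diamond; suff -> : diamond (X := X) d b = diamond d a by [].
apply/funext => t; apply/funext => z; rewrite /diamond.
by case/orP: ba => /eqP ->; rewrite // mateK orbC.
Qed.

Lemma diamond_cover d (x : surface X) :
  (forall d', d' <> d -> 0 < descend (deco_bary d') x) ->
  exists t0, in_diamond d t0 x.
Proof.
have [t [z [rz ->]]] := chart_surj x => h; exists t; apply/in_diamondP.
exists t, z; split=> //; first by rewrite eqxx.
all: rewrite -deco_bary_vdeco -descend_chart //; try exact: deco_bary_compatible.
all: apply: h => e; have := etrans e (esym (kind_side_of t d));
  move/vdeco_inj/eqP => /=.
  by rewrite eq_sym (negbTE (ordSS_neq _)).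
by rewrite eq_sym (negbTE (ordS_neq _)).
Qed.

(* The labels [a] and [b] are locally constant along paths, so the coincidence
   set of two lifts is clopen. *)
Lemma same_fibre_eq d a b (x y : surface X) : in_diamond d a x ->
  in_diamond d b y -> f x = f y -> x = y <-> (b == a) || (b == mate d a).
Proof.
move=> xa yb fxy; split=> [xy|ba].
  by rewrite -xy in yb; exact: in_diamond_label xa yb.
by apply: (diamond_inj xa) => //; rewrite -(in_diamond_mate ba).
Qed.

(** The hypothesis on [c] says that at most one coordinate vanishes at a time, so that every point
    above [c t] lies in a diamond by [diamond_cover]. *)
Lemma lift_unique (c : R -> surface (double_triangle R)) (T : R) x u v :
  (forall t, t \in `[0, T] ->
     exists d, forall d', d' <> d -> 0 < descend (deco_bary d') (c t)) ->
  is_lift f c T x u -> is_lift f c T x v -> forall t, t \in `[0, T] -> u t = v t.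
Proof.
move=> cT [uc u0 fu] [vc v0 fv].
(* Near [t] both lifts stay in the diamonds they occupy at [t], and there agreement depends only on
   the labels [a] and [b]. *)
have loc t : t \in `[0, T] ->
    \forall s \near t, s \in `[0, T] -> (u s = v s <-> u t = v t).
  move=> tT; have [d dpos] := cT t tT.
  have [|a ua] := @diamond_cover d (u t).
    by move=> d' /dpos; rewrite -fu ?belyi_deco_bary //.
  have [|b vb] := @diamond_cover d (v t).
    by move=> d' /dpos; rewrite -fv ?belyi_deco_bary //.
  have un : \forall s \near t, s \in `[0, T] -> in_diamond d a (u s).
    apply: (proj1 (subspace_continuousP _ u) uc t tT (in_diamond d a)).
    by apply: open_nbhs_nbhs; split=> //; exact: open_in_diamond.
  have vn : \forall s \near t, s \in `[0, T] -> in_diamond d b (v s).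
    apply: (proj1 (subspace_continuousP _ v) vc t tT (in_diamond d b)).
    by apply: open_nbhs_nbhs; split=> //; exact: open_in_diamond.
  near=> s => sT.
  rewrite (same_fibre_eq ua vb); last by rewrite fu ?fv //.
  apply: same_fibre_eq; [exact: (near un s)|exact: (near vn s)|].
  by rewrite fu ?fv //.
move=> t tT.
have T0 : (0 : R) \in `[0, T].
  by move: tT; rewrite !in_itv /= lexx => /andP[]; exact: le_trans.
pose E := [set s | s \in `[0, T] /\ u s = v s].
suff : E = [set` `[0, T]] by move/seteqP => [_ /(_ _ tT)[]].
(* By [loc], agreement and disagreement are both relatively open; the closed set required is the
   complement of the interior of disagreement. *)
apply: (@segment_connected R 0 T).
- by exists 0; split=> //; rewrite u0 v0.
- exists (interior [set s | s \in `[0, T] -> u s = v s]); first exact: open_interior.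
  apply/seteqP; split=> s; last by move=> [sT /nbhs_singleton h]; split=> //; exact: h.
  move=> [sT e]; split=> //; move: (loc s sT); apply: filterS => r h rT.
  by apply/h.
- exists (~` interior [set s | s \in `[0, T] -> u s <> v s]).
    by rewrite closedC; exact: open_interior.
  apply/seteqP; split=> s.
    by move=> [sT e]; split=> // /nbhs_singleton h; exact: h.
  move=> [sT n]; split=> //; apply: contrapT => ne; apply: n.
  by move: (loc s sT); apply: filterS => r h rT /h/ne.
Unshelve. all: by end_near.
Qed.

End BelyiLifts.

(** * The Eisenstein lattice, [Hex] and [Gamma333] *)

Lemma tripleE (A : Type) (a b c : A) : ((triple a b c ord0 = a) *
  (triple a b c (ordS ord0) = b) * (triple a b c (ordS (ordS ord0)) = c))%type.
Proof. by []. Qed.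

Section EisensteinLattice.
Variable R : realType.
Local Notation w := (omega R).
Implicit Types (z : R[i]) (a b : int).

Lemma omega_sqr : w ^+ 2 = w - 1.
Proof.
have s2 := sin_third_sq R; have c := cos_third R.
apply/eqP; rewrite eq_complex /omega expr2 /= c.
by apply/andP; split; apply/eqP; rewrite -?expr2 ?s2; field.
Qed.

Lemma omega6 : w ^+ 6 = 1.
Proof. by rewrite (exprM w 2 3) omega_sqr; ring: omega_sqr. Qed.

Lemma nsq_coord (x y : R) : nsq (x%:C + y%:C * w) = x ^+ 2 + x * y + y ^+ 2.
Proof.
have s2 := sin_third_sq R; have c := cos_third R.
transitivity ((x + y / 2) ^+ 2 + y ^+ 2 * sin (2 * pi / 6) ^+ 2).
  by rewrite /nsq /omega /= c; field.
by rewrite s2; field.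
Qed.

Lemma coord_inj (x y x' y' : R) :
  x%:C + y%:C * w = x'%:C + y'%:C * w -> x = x' /\ y = y'.
Proof.
have s0 := sin_third_gt0 R; have c := cos_third R.
move/eqP; rewrite eq_complex /omega /= c => /andP[/eqP e1 /eqP e2].
have yy : y = y' by apply: (mulIf (lt0r_neq0 s0)); lra.
by split=> //; rewrite yy in e1; lra.
Qed.

Lemma intrC a : a%:~R = (a%:~R : R)%:C.
Proof. by rewrite rmorph_int. Qed.

Lemma HexD z z' : Hex z -> Hex z' -> Hex (z + z').
Proof.
by move=> [a [b ->]] [a' [b' ->]]; exists (a + a'), (b + b'); rewrite !intrD; ring.
Qed.

Lemma HexN z : Hex z -> Hex (- z).
Proof.
by move=> [a [b ->]]; exists (- a), (- b); rewrite !mulrNz; ring.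
Qed.

Lemma Hex0 : Hex (0 : R[i]).
Proof. by exists 0, 0; rewrite !mul0r addr0. Qed.

Lemma HexB z z' : Hex z -> Hex z' -> Hex (z - z').
Proof. by move=> h h'; apply: HexD => //; exact: HexN. Qed.

Lemma Hex_rot z : Hex z -> Hex (w ^+ 2 * z).
Proof.
move=> [a [b ->]]; exists (- a - b), a; rewrite intrD !mulrNz.
by ring: omega_sqr.
Qed.

Lemma Hex_rotn j z : Hex z -> Hex (w ^+ (2 * j) * z).
Proof.
move=> hz; elim: j => [|j IH]; first by rewrite muln0 expr0 mul1r.
by rewrite mulnS exprD -mulrA; exact: Hex_rot.
Qed.

Lemma Hex_intr k z : Hex z -> Hex (k%:~R * z).
Proof.
by move=> [a [b ->]]; exists (k * a), (k * b); rewrite !intrM; ring.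
Qed.

(** [Hex] is the kernel of [a - b] modulo 3. The coefficients come from solving [a = 2 c + d] and
    [b = d - c]. *)
Lemma HexP a b : Hex (a%:~R + b%:~R * w) <-> exists c, a - b = 3 * c.
Proof.
split=> [[c [d]]|[c abc]].
  have -> : c%:~R * (2 - w) + d%:~R * (1 + w) =
      (2 * c + d)%:~R + (d - c)%:~R * w by rewrite !intrD intrM mulrNz; ring.
  rewrite !intrC => /coord_inj[/intr_inj -> /intr_inj ->].
  by exists c; ring.
exists c, (b + c); have -> : a = 3 * c + b by rewrite -abc subrK.
by rewrite !intrD !intrM; ring.
Qed.

(** Multiplication by [w ^+ 2 - 1 = w - 2] sends the basis 1, [w] of [Lambda] to minus the basis of
    [Hex]; thus rotations of order 3 fix the classes modulo [Hex]. *)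
Lemma Lambda_rotB z : Lambda z -> Hex (w ^+ 2 * z - z).
Proof.
move=> [a [b ->]]; exists (- a), (- b); rewrite !mulrNz.
by ring: omega_sqr.
Qed.

Lemma Lambda_rotnB j z : Lambda z -> Hex (w ^+ (2 * j) * z - z).
Proof.
move=> lz; elim: j => [|j IH]; first by rewrite muln0 expr0 mul1r subrr; exact: Hex0.
have -> : w ^+ (2 * j.+1) * z - z =
    w ^+ 2 * (w ^+ (2 * j) * z - z) + (w ^+ 2 * z - z).
  by rewrite mulnS exprD; ring.
by apply: HexD; [exact: Hex_rot|exact: Lambda_rotB].
Qed.

Lemma Lambda_vtx k : Lambda (vtx (Delta R) k).
Proof.
elim/ord3_cases: k; [exists 0, 0|exists 1, 0|exists 0, 1]; rewrite /= tripleE; ring.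
Qed.

Lemma vtx_Delta_rotation k z :
  rotation (vtx (Delta R) k) z =
  w ^+ 2 * z + (vtx (Delta R) k - w ^+ 2 * vtx (Delta R) k).
Proof. by rewrite /rotation; ring. Qed.

(* [Gamma333] is the semidirect product of [Hex] and the rotations of order 3. *)
Lemma Gamma333_affine g : Gamma333 g ->
  exists j c, Hex c /\ forall z, g z = w ^+ (2 * j) * z + c.
Proof.
elim=> {g} [|k|g h _ [j [c [hc gE]]] _ [j' [c' [hc' hE]]]|g h _ [j [c [hc gE]]] _ hK].
- by exists 0%N, 0; split=> [|z]; [exact: Hex0|rewrite mul1r addr0].
- exists 1%N, (vtx (Delta R) k - w ^+ 2 * vtx (Delta R) k); split=> [|z].
    by rewrite -opprB; apply/HexN/Lambda_rotB/Lambda_vtx.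
  by rewrite vtx_Delta_rotation.
- exists (j + j')%N, (w ^+ (2 * j) * c' + c); split=> [|z].
    by apply: HexD => //; exact: Hex_rotn.
  by rewrite /= gE hE mulnDr exprD; ring.
(* The inverse of [w ^+ (2 * j)] is [w ^+ (4 * j)], since [w ^+ 6 = 1]. *)
- exists (2 * j)%N, (- (w ^+ (2 * (2 * j)) * c)); split=> [|z].
    by apply/HexN/Hex_rotn.
  have e : w ^+ (2 * (2 * j)) * w ^+ (2 * j) = 1.
    rewrite -exprD (_ : (_ + _)%N = (6 * j)%N); last by lia.
    by rewrite exprM omega6 expr1n.
  by rewrite -{2}(hK z) gE; ring: e.
Qed.

Lemma Gamma333_rot0 j : Gamma333 (fun z => w ^+ (2 * j) * z).
Proof.
elim: j => [|j IH].
  rewrite (_ : (fun z => _) = id); first exact: Gamma333_id.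
  by apply/funext => z; rewrite mul1r.
rewrite (_ : (fun z => _) =
    rotation (vtx (Delta R) ord0) \o (fun z => w ^+ (2 * j) * z)).
  by apply: Gamma333_comp => //; exact: Gamma333_rot.
by apply/funext => z /=; rewrite /rotation /= tripleE mulnS exprD; ring.
Qed.

(** Rotating by [w ^+ 4] about 0 and then by [w ^+ 2] about a vertex [v] is the translation by
    [v - w ^+ 2 * v]. For [v = 1] and [v = w] this gives the generators [2 - w] and [1 + w]. *)
Lemma Gamma333_translation c : Hex c -> Gamma333 (fun z => z + c).
Proof.
have tr k : Gamma333 (fun z => z + (vtx (Delta R) k - w ^+ 2 * vtx (Delta R) k)).
  rewrite (_ : (fun z => _) =
      rotation (vtx (Delta R) k) \o (fun z => w ^+ (2 * 2) * z)).
    by apply: Gamma333_comp; [exact: Gamma333_rot|exact: Gamma333_rot0].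
  apply/funext => z; rewrite /= vtx_Delta_rotation mulrA -exprD.
  by rewrite (_ : (2 + 2 * 2)%N = 6) // omega6 mul1r.
have trn c' : Gamma333 (fun z => z + c') -> forall n : nat,
    Gamma333 (fun z => z + n%:R * c').
  move=> h; elim=> [|n IH].
    rewrite (_ : (fun z => _) = id); first exact: Gamma333_id.
    by apply/funext => z; rewrite mul0r addr0.
  rewrite (_ : (fun z => _) = (fun z => z + c') \o (fun z => z + n%:R * c')).
    exact: Gamma333_comp.
  by apply/funext => z /=; rewrite -natr1; ring.
have trz c' : Gamma333 (fun z => z + c') -> forall n : int,
    Gamma333 (fun z => z + n%:~R * c').
  move=> h [n|n]; first exact: trn.
  apply: (Gamma333_inv (trn c' h n.+1)) => z; rewrite NegzE mulrNz; ring.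
move=> [a [b ->]].
rewrite (_ : (fun z => _) =
    (fun z => z + a%:~R * (2 - w)) \o (fun z => z + b%:~R * (1 + w))).
  apply: Gamma333_comp; apply: trz.
    have := tr (ordS ord0); congr Gamma333; apply/funext => z.
    by rewrite /= tripleE; ring: omega_sqr.
  have := tr (ordS (ordS ord0)); congr Gamma333; apply/funext => z.
  by rewrite /= tripleE; ring: omega_sqr.
by apply/funext => z /=; ring.
Qed.

Lemma affine_Gamma333 j c : Hex c -> Gamma333 (fun z => w ^+ (2 * j) * z + c).
Proof.
by move=> /Gamma333_translation hc; exact: Gamma333_comp hc (Gamma333_rot0 j).
Qed.

(** On [Hex] the squared norm is three times an integer. *)
Lemma Hex_nsq z : Hex z -> nsq z <> 1.
Proof.
move=> [a [b ->]].
have -> : a%:~R * (2 - w) + b%:~R * (1 + w) =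
    (2 * a%:~R + b%:~R)%:C + (b%:~R - a%:~R)%:C * w.
  by rewrite rmorphB rmorphD rmorphM /= -!intrC rmorph_nat; ring.
rewrite nsq_coord.
have -> : (2 * a%:~R + b%:~R) ^+ 2 + (2 * a%:~R + b%:~R) * (b%:~R - a%:~R)
    + (b%:~R - a%:~R) ^+ 2 = (3 * (a ^+ 2 + a * b + b ^+ 2))%:~R :> R.
  by rewrite intrM !intrD !rmorphXn intrM /=; ring.
move/eqP; rewrite (_ : 1 = 1%:~R) // eqr_int => /eqP; lia.
Qed.

Lemma LambdaP z : Lambda z -> exists a b,
  z = (a%:~R : R)%:C + (b%:~R : R)%:C * w /\ z = a%:~R + b%:~R * w.
Proof. by move=> [a [b zE]]; exists a, b; rewrite -!intrC. Qed.

Lemma LambdaB z z' : Lambda z -> Lambda z' -> Lambda (z - z').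
Proof.
move=> [a [b ->]] [a' [b' ->]]; exists (a - a'), (b - b').
by rewrite !intrD !mulrNz; ring.
Qed.

(** A unit norm bounds both integer coordinates and leaves the six powers of [w]; being congruent to
    1 modulo [Hex] selects the even ones. *)
Lemma unit_rot z : Lambda z -> Hex (z - 1) -> nsq z = 1 -> exists j, z = w ^+ (2 * j).
Proof.
move=> /LambdaP[a [b [zE zE']]] h; rewrite {1}zE nsq_coord => e.
have {}e : a ^+ 2 + a * b + b ^+ 2 = 1.
  by apply/eqP; rewrite -(eqr_int R) !intrD !rmorphXn intrM /= e.
have [c cE] : exists c, (a - 1) - b = 3 * c.
  apply/HexP; move: h; rewrite zE' intrD mulrNz; congr Hex; ring.
have hb : -1 <= b <= 1 by nia.
have ha : -1 <= a <= 1 by nia.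
have [[a1 b1]|[[a1 b1]|[a1 b1]]] :
    (a = 1 /\ b = 0) \/ ((a = -1 /\ b = 1) \/ (a = 0 /\ b = -1)) by nia.
- by exists 0%N; rewrite zE' a1 b1; ring.
- by exists 1%N; rewrite zE' a1 b1 omega_sqr; ring.
- by exists 2; rewrite zE' a1 b1 (exprM w 2 2) omega_sqr; ring: omega_sqr.
Qed.

End EisensteinLattice.

(** * Tiles, their models and the covering of the plane *)

Section Tiles.
Variable R : realType.
Local Notation w := (omega R).
Implicit Types (Q : ptriangle R) (z : R[i]).

Lemma vdeco_Delta_inj : injective (vdeco (Delta R)).
Proof. exact: (@vdeco_inj R (double_triangle R) true). Qed.

(** [Gamma333] preserves classes modulo [Hex] on [Lambda], so the decoration of a vertex fixes its
    class. *)
Lemma tile_vtx_class Q j k : tile Q -> vdeco Q j = vdeco (Delta R) k ->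
  Hex (vtx Q j - vtx (Delta R) k).
Proof.
move=> [_ _ tg]; have [g Gg [l -> ->]] := tg j => /vdeco_Delta_inj <-.
have [i [c [hc gE]]] := Gamma333_affine Gg; rewrite gE addrAC.
by apply: HexD => //; exact/Lambda_rotnB/Lambda_vtx.
Qed.

(** Two corners with the same decoration would differ by a unit vector of [Hex], against
    [Hex_nsq]. *)
Lemma tile_vdeco_inj Q : tile Q -> injective (vdeco Q).
Proof.
move=> tQ j k jk; apply/eqP/negP => /negP njk.
have [l lE] := deco_surj vdeco_Delta_inj (vdeco Q j).
have := HexB (tile_vtx_class tQ (esym lE))
  (tile_vtx_class tQ (etrans (esym jk) (esym lE))).
rewrite opprB addrA subrK => /Hex_nsq; apply.
by case: tQ => _ u _; exact: unit_nsq.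
Qed.

Lemma unit_apex z : nsq z = 1 -> nsq (z - 1) = 1 -> z = w \/ z = w^*.
Proof.
have s2 := sin_third_sq R; have c := cos_third R.
case: z => x y; rewrite /nsq /= => e1 e2.
have xE : x = 1 / 2 by nra.
have : (y - sin (2 * pi / 6)) * (y + sin (2 * pi / 6)) = 0.
  by rewrite -subr_sqr s2; rewrite xE in e1; lra.
move/eqP; rewrite mulf_eq0 subr_eq0 addr_eq0 => /orP[]/eqP yE; [left|right];
  by rewrite /omega /= c xE yE.
Qed.

Lemma nsqM z z' : nsq (z * z') = nsq z * nsq z'.
Proof. by case: z z' => a b [c d]; rewrite /nsq /=; ring. Qed.

Lemma nsq_omega : nsq w = 1.
Proof.
have := nsq_coord (0 : R) 1; rewrite mul1r add0r => ->.
by ring.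
Qed.

Lemma nsq_omegaX n : nsq (w ^+ n) = 1.
Proof.
elim: n => [|n IH]; first by rewrite /nsq /=; ring.
by rewrite exprS nsqM IH nsq_omega mulr1.
Qed.

(** Move the [Circ] corner to 0 and rotate the [Bullet] corner to 1, possible by [unit_rot]. The
    [Ast] corner becomes [x], which is [w] or its conjugate; this decides between [Delta] and
    [Delta_bar]. *)
Lemma tile_Gamma333 Q : tile Q -> exists (b : bool) j c, Hex c /\
  forall k l, vdeco Q k = vdeco (double_tri R b) l ->
    vtx Q k = w ^+ (2 * j) * vtx (double_tri R b) l + c.
Proof.
move=> tQ; have qi := tile_vdeco_inj tQ; have [lam u _] := tQ.
have [vc cE] := deco_surj qi Circ; have [vb bE] := deco_surj qi Bullet.
have [va aE] := deco_surj qi Ast.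
have hc := tile_vtx_class tQ (cE : _ = vdeco (Delta R) ord0).
have hb := tile_vtx_class tQ (bE : _ = vdeco (Delta R) (ordS ord0)).
rewrite /= !tripleE subr0 in hc hb.
have [j jE] : exists j, vtx Q vb - vtx Q vc = w ^+ (2 * j).
  apply: unit_rot; first exact: LambdaB.
    by rewrite addrAC; exact: HexB.
  by apply: unit_nsq => //; apply/eqP => e; rewrite e cE in bE.
have ww : w ^+ (2 * (2 * j)) * w ^+ (2 * j) = 1.
  rewrite -exprD (_ : (_ + _)%N = (6 * j)%N); last by lia.
  by rewrite exprM omega6 expr1n.
pose x := w ^+ (2 * (2 * j)) * (vtx Q va - vtx Q vc).
have xE : vtx Q va - vtx Q vc = w ^+ (2 * j) * x.
  by rewrite /x mulrA [w ^+ _ * _]mulrC ww mul1r.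
have n1 : nsq x = 1.
  rewrite /x nsqM nsq_omegaX mul1r; apply: unit_nsq => //.
  by apply/eqP => e; rewrite e cE in aE.
have n2 : nsq (x - 1) = 1.
  rewrite -{1}ww /x -mulrBr -jE opprB addrA subrK nsqM nsq_omegaX mul1r.
  by apply: unit_nsq => //; apply/eqP => e; rewrite e bE in aE.
have [b vE] : exists b, forall l, vtx (double_tri R b) l =
    match vdeco (double_tri R b) l with Circ => 0 | Bullet => 1 | Ast => x end.
  have [->|->] := unit_apex n1 n2; [exists true|exists false];
    by elim/ord3_cases; rewrite /= !tripleE.
exists b, j, (vtx Q vc); split=> // k l; rewrite vE => <-.
case kE : (vdeco Q k).
- by rewrite mulr0 add0r; congr vtx; apply: qi; rewrite kE.
- by rewrite mulr1 -jE subrK; congr vtx; apply: qi; rewrite kE.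
- by rewrite -xE subrK; congr vtx; apply: qi; rewrite kE.
Qed.

Lemma black_corners Q kc kb ka : injective (vdeco Q) ->
  vdeco Q kc = Circ -> vdeco Q kb = Bullet -> vdeco Q ka = Ast ->
  black Q <-> positively_oriented (vtx Q kc) (vtx Q kb) (vtx Q ka).
Proof.
move=> qi ec eb ea; split=> [[j0 [j1 [j2 [e0 e1 e2]]]]|p]; last by exists kc, kb, ka.
have -> : j0 = kc by apply: qi; rewrite e0.
have -> : j1 = kb by apply: qi; rewrite e1.
by have -> : j2 = ka by apply: qi; rewrite e2.
Qed.

(** Multiplication by [s] scales oriented areas by [nsq s]. *)
Lemma positively_oriented_affine (s c x y z : R[i]) : nsq s = 1 ->
  positively_oriented (s * x + c) (s * y + c) (s * z + c) <->
  positively_oriented x y z.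
Proof.
move=> s1; rewrite /positively_oriented.
have -> : complex.Im ((s * y + c - (s * x + c))^* * (s * z + c - (s * x + c)))
    = nsq s * complex.Im ((y - x)^* * (z - x)).
  case: s c x y z {s1} => [? ?] [? ?] [? ?] [? ?] [? ?]; rewrite /nsq /=; ring.
by rewrite s1 mul1r.
Qed.

Lemma orbit_projection_Gamma (q : R[i] -> surface (double_triangle R)) g z :
  orbit_projection q -> Gamma333 g -> q (g z) = q z.
Proof. by move=> [_ _ qG] Gg; apply/esym/qG; exists g. Qed.

(** An element of [Gamma333] carries [Delta] or [Delta_bar] to the tile. As [q] is invariant under
    it, [q z] is the chart value at the point [z0] with the same coordinates in the model. *)
Lemma orbit_projection_represents (q : R[i] -> surface (double_triangle R)) Q z :
  orbit_projection q -> tile Q -> region Q z -> represents Q z (q z).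
Proof.
move=> hq tQ [c [c0 c1 zE]]; have qi := tile_vdeco_inj tQ; have [_ u _] := tQ.
have [b [j [t [ht vE]]]] := tile_Gamma333 tQ.
have di : injective (vdeco (double_tri R b)) := @vdeco_inj R (double_triangle R) b.
have [s si sE] := vdeco_matching di qi.
pose z0 := \sum_k (c (s k))%:C * vtx (double_tri R b) k.
have c1' : \sum_k c (s k) = 1 by rewrite -c1 [RHS](reindex_inj si).
have r0 : region (double_tri R b) z0 by exists (c \o s); split=> //= k.
have zE0 : z = w ^+ (2 * j) * z0 + t.
  rewrite zE (reindex_inj si) /= /z0 mulr_sumr.
  have -> : t = \sum_k (c (s k))%:C * t by rewrite -mulr_suml -rmorph_sum c1' mul1r.
  rewrite -big_split /=; apply: eq_bigr => k _.
  by rewrite (vE _ _ (esym (sE k))); ring.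
exists b, z0; split=> //.
- rewrite {1}zE0 (orbit_projection_Gamma _ hq (affine_Gamma333 j ht)).
  by case: hq => qT qF _; case: b {vE di sE zE0} @z0 r0 => z0 r0; [exact: qT|exact: qF].
- move=> k l kl; have -> : k = s l by apply: qi; rewrite kl sE.
  rewrite {1}zE bary_convex // /z0.
  by rewrite (@bary_convex _ _ (c \o s)) //; exact: double_tri_unit.
have cc d : exists2 k, vdeco Q k = d & exists2 l, vdeco (double_tri R b) l = d &
    vtx Q k = w ^+ (2 * j) * vtx (double_tri R b) l + t.
  have [k kd] := deco_surj qi d; have [l ld] := deco_surj di d.
  by exists k => //; exists l => //; apply: vE; rewrite kd ld.
have [k0 k0d [l0 l0d e0]] := cc Circ; have [k1 k1d [l1 l1d e1]] := cc Bullet.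
have [k2 k2d [l2 l2d e2]] := cc Ast.
rewrite (black_corners qi k0d k1d k2d) (black_corners di l0d l1d l2d) e0 e1 e2.
exact: positively_oriented_affine (nsq_omegaX _).
Qed.

Lemma Lambda_Gamma333 z : Lambda z ->
  exists2 g, Gamma333 g & exists l, z = g (vtx (Delta R) l).
Proof.
move=> [a [b ->]].
have [l hl] : exists l, Hex (a%:~R + b%:~R * w - vtx (Delta R) l).
  have e3 : exists c : int, [\/ a - b = 3 * c, a - 1 - b = 3 * c | a - (b - 1) = 3 * c].
    (* The shift by 1 turns the remainders 0, 1, 2 into the classes -1, 0, 1 of [a - b], represented
       by [w], 0 and 1. *)
    exists ((a - b + 1) %/ 3)%Z; have := divz_eq (a - b + 1) 3.
    have := ltz_pmod (a - b + 1) (isT : 0 < 3 :> int).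
    have := modz_ge0 (a - b + 1) (isT : 3 != 0 :> int).
    move: (_ %/ _)%Z (_ %% _)%Z => c r r0 r3 e.
    have [h|[h|h]] : r = 0 \/ (r = 1 \/ r = 2) by lia.
    - by constructor 3; lia.
    - by constructor 1; lia.
    - by constructor 2; lia.
  have [c [h|h|h]] := e3; [exists ord0|exists (ordS ord0)|exists (ordS (ordS ord0))];
    rewrite /= tripleE.
  - by rewrite subr0; apply/HexP; exists c.
  - rewrite addrAC -[X in _ - X]/(1%:~R) -intrB; apply/HexP; exists c; lia.
  - rewrite -addrA -[X in _ - X]mul1r -[X in _ - X * _]/(1%:~R) -mulrBl -intrB.
    by apply/HexP; exists c; lia.
exists (fun z => z + (a%:~R + b%:~R * w - vtx (Delta R) l)).
  exact: Gamma333_translation.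
by exists l; rewrite [RHS]addrC subrK.
Qed.

(** The decoration is constructed: each corner takes that of a vertex of [Delta] in its [Gamma333]
    orbit. *)
Lemma tile_of (v : 'I_3 -> R[i]) : (forall k, Lambda (v k)) ->
  (forall k, `|v (ordS k) - v k| = 1) -> exists2 Q, tile Q & vtx Q = v.
Proof.
move=> lv uvS.
have uv j k : j != k -> `|v j - v k| = 1.
  have [->|->|->] := ordSP k j; rewrite ?eqxx // => _.
  by rewrite distrC -[X in v X - _]ordS3 uvS.
have /choice[l lE] k : exists l, exists2 g, Gamma333 g & v k = g (vtx (Delta R) l).
  by have [g Gg [l lE]] := Lambda_Gamma333 (lv k); exists l, g.
exists (PTriangle v (fun k => vdeco (Delta R) (l k))) => //; split=> //= k.
by have [g Gg e] := lE k; exists g => //; exists (l k).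
Qed.

(** The floors of the coordinates in the basis 1, [w] place [z] in a unit parallelogram, which the
    diagonal [s + t = 1] cuts into two tiles. *)
Lemma tile_cover z : exists2 Q, tile Q & region Q z.
Proof.
have [x [y zE]] : exists x y : R, z = x%:C + y%:C * w.
  have s0 := lt0r_neq0 (sin_third_gt0 R); have c := cos_third R.
  case: z => x y; exists (x - y / sin (2 * pi / 6) / 2), (y / sin (2 * pi / 6)).
  by apply/eqP; rewrite eq_complex /omega /= c; apply/andP; split; apply/eqP; field.
pose p : R[i] := (Num.floor x)%:~R + (Num.floor y)%:~R * w.
have lp (a b : int) : Lambda (p + (a%:~R + b%:~R * w)).
  by exists (Num.floor x + a), (Num.floor y + b); rewrite !intrD /p; ring.
have n1 (a b : int) : a ^+ 2 + a * b + b ^+ 2 = 1 -> `|a%:~R + b%:~R * w| = 1.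
  move=> e; apply/norm1_nsq; rewrite !intrC nsq_coord.
  have := congr1 (fun k : int => k%:~R : R) e.
  by rewrite !intrD !rmorphXn intrM /= => ->.
have [s0 s1] : 0 <= x - (Num.floor x)%:~R /\ x - (Num.floor x)%:~R < 1.
  by have /andP[] := floor_itv x; rewrite intrD; split; lra.
have [t0 t1] : 0 <= y - (Num.floor y)%:~R /\ y - (Num.floor y)%:~R < 1.
  by have /andP[] := floor_itv y; rewrite intrD; split; lra.
have {}zE : z = p + ((x - (Num.floor x)%:~R)%:C + (y - (Num.floor y)%:~R)%:C * w).
  by rewrite zE /p !rmorphB /= -!intrC; ring.
move: (x - _) (y - _) zE s0 s1 t0 t1 => s t zE s0 s1 t0 t1.
have n10 := n1 1 0 erefl; have n01 := n1 0 1 erefl; have n11 := n1 (-1) 1 erefl.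
have [st|st] := lerP (s + t) 1.
  have [||Q tQ vQ] := @tile_of (triple (p + (0%:~R + 0%:~R * w))
      (p + (1%:~R + 0%:~R * w)) (p + (0%:~R + 1%:~R * w))).
  - by elim/ord3_cases; rewrite tripleE.
  - elim/ord3_cases; rewrite ?ordS3 !tripleE.
    + by rewrite -[RHS]n10; congr `|_|; ring.
    + by rewrite -[RHS]n11; congr `|_|; rewrite !mulrNz; ring.
    + by rewrite -[RHS]n01 -normrN; congr `|_|; ring.
  exists Q => //; exists (triple (1 - s - t) s t); split.
  - by elim/ord3_cases; rewrite tripleE //; lra.
  - by rewrite (sum_ord3 _ ord0) !tripleE; ring.
  - by rewrite (sum_ord3 _ ord0) vQ !tripleE zE !rmorphB /=; ring.
have [||Q tQ vQ] := @tile_of (triple (p + (1%:~R + 1%:~R * w))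
      (p + (1%:~R + 0%:~R * w)) (p + (0%:~R + 1%:~R * w))).
- by elim/ord3_cases; rewrite tripleE.
- elim/ord3_cases; rewrite ?ordS3 !tripleE.
  + by rewrite -[RHS]n01 -normrN; congr `|_|; ring.
  + by rewrite -[RHS]n11; congr `|_|; rewrite !mulrNz; ring.
  + by rewrite -[RHS]n10; congr `|_|; ring.
exists Q => //; exists (triple (s + t - 1) (1 - t) (1 - s)); split.
- by elim/ord3_cases; rewrite tripleE //; lra.
- by rewrite (sum_ord3 _ ord0) !tripleE; ring.
- by rewrite (sum_ord3 _ ord0) vQ !tripleE zE !(rmorphB, rmorphD) /=; ring.
Qed.

End Tiles.

(** * The line, its period and its development *)

Section Development.
Variable R : realType.
Local Notation w := (omega R).

(** Eliminating [t] from [a = 1/2 + t m] and [b = t n] gives [n = 2 (a n - m b)], impossible for odd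
    [n]. *)
Lemma line_Lambda (m n : int) (t : R) : odd `|n|%N ->
  ~ Lambda (line (m%:~R + n%:~R * w) t).
Proof.
move=> on [a [b]]; rewrite /line.
have -> : 1 / 2 + t%:C * (m%:~R + n%:~R * w) =
    (1 / 2 + t * m%:~R)%:C + (t * n%:~R)%:C * w.
  rewrite rmorphD !rmorphM fmorphV rmorph1 rmorph_nat /= -!intrC; ring.
rewrite !intrC => /coord_inj[e1 e2].
have e : n%:~R = (2 * (a * n - m * b))%:~R :> R.
  by rewrite intrM intrB !intrM -e1 -e2; field.
by move/intr_inj: e => e; lia.
Qed.

Lemma line_period_gt0 (z : R[i]) : 0 < line_period z.
Proof. by rewrite /line_period; case: ifP. Qed.

(** When [omega0] is not in [Hex], three times it is, because [Hex] is defined by a congruence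
    modulo 3. *)
Lemma line_period_Hex (m n : int) :
  Hex ((line_period (m%:~R + n%:~R * w))%:C * (m%:~R + n%:~R * w)).
Proof.
rewrite /line_period; case: asboolP => h; first by rewrite rmorph1 mul1r.
rewrite rmorph_nat (_ : 3%:R * _ = (3 * m)%:~R + (3 * n)%:~R * w); last first.
  by rewrite !intrM; ring.
by apply/HexP; exists (m - n); lia.
Qed.

Lemma lineD (z : R[i]) s t : line z (s + t) = line z t + s%:C * z.
Proof. by rewrite /line rmorphD /=; ring. Qed.

Lemma orbit_projection_periodic (q : R[i] -> surface (double_triangle R))
    (z : R[i]) (T : R) (k : nat) t : orbit_projection q -> Hex (T%:C * z) ->
  q (line z (k%:R * T + t)) = q (line z t).
Proof.
move=> hq hT; rewrite lineD rmorphM rmorph_nat /= -mulrA.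
apply: (orbit_projection_Gamma (g := fun x => x + k%:R * (T%:C * z)) _ hq).
exact/Gamma333_translation/(Hex_intr k).
Qed.

(** Two vanishing coordinates would put [z] at a corner of the tile, hence in [Lambda]; so two
    coordinates are positive, and [x] has the same ones. *)
Lemma represents_nonvertex (Y : decorated_triangulation R) (Q : ptriangle R) z
    (x : surface Y) : tile Q -> region Q z -> ~ Lambda z -> represents Q z x ->
  exists d, forall d', d' <> d -> 0 < descend (deco_bary d') x.
Proof.
move=> tQ rz nz [t [v [rv -> bv _]]]; have [lam u _] := tQ.
have qi := tile_vdeco_inj tQ; have [b0 _] := region_bary u rz.
have bs := bary_sum Q z.
suff [k h1 h2] : exists2 k, 0 < bary Q (ordS k) z & 0 < bary Q (ordS (ordS k)) z.
  exists (vdeco Q k) => d' dk; have [j jd] := deco_surj qi d'.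
  rewrite descend_chart //; last exact: deco_bary_compatible.
  rewrite /deco_bary -(bv j); last by rewrite vdeco_corner //; exact: vdeco_inj.
  have [jk|->|->] // := ordSP k j.
  by case: dk; rewrite -jd jk.
have pos k : bary Q k z = 0 \/ 0 < bary Q k z.
  by have := b0 k; rewrite le_eqVlt => /orP[/eqP <-|]; [left|right].
have nv k : bary Q (ordS k) z = 0 -> 0 < bary Q (ordS (ordS k)) z.
  move=> e1; have [e2|//] := pos (ordS (ordS k)).
  by case: nz; rewrite (bary_eq1 u rz e1 e2).
have [e|h1] := pos (ordS ord0).
  have h := nv _ e.
  exists (ordS ord0) => //; rewrite ordS3.
  have [e'|//] := pos ord0.
  by have := nv (ordS (ordS ord0)); rewrite ordS3 e => /(_ e'); rewrite ltxx.
have [e|h2] := pos (ordS (ordS ord0)); last by exists ord0.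
exists (ordS (ordS ord0)); rewrite ordS3 //.
by have := nv (ordS ord0) e; rewrite ordS3.
Qed.

Section WithMaps.
Variables (X : decorated_triangulation R)
  (f : surface X -> surface (double_triangle R)).
Hypothesis hf : belyi_function f.
Variables (q : R[i] -> surface (double_triangle R)) (hq : orbit_projection q).
Variables (z : R[i]) (p : surface X) (Psi : R[i] -> surface X).
Hypothesis hPsi : development z p Psi.

Lemma line_tile t : exists Q, [/\ tile Q, meets_line z Q & region Q (line z t)].
Proof. by have [Q tQ rQ] := tile_cover (line z t); exists Q; split=> //; exists t. Qed.

(** [Psi] is continuous only within the strip, but by [line_tile] the whole line lies in it. *)
Lemma development_continuous : continuous (Psi \o line z).
Proof.
have [Pc _ _] := hPsi; move=> t U nU.
have near_line : \forall s \near line z t, strip z s -> U (Psi s).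
  exact: (proj1 (subspace_continuousP _ Psi) Pc (line z t) (line_tile t) U nU).
have : \forall s \near t, strip z (line z s) -> U (Psi (line z s)).
  exact: (@continuous_line _ z t _ near_line).
by apply: filterS => s; apply; exact: line_tile.
Qed.

(** Both sides represent the same point of one tile: [Psi] followed by [f] preserves coordinates and
    colour, as does [q], so [represents_inj] applies. *)
Lemma development_lifts t : f (Psi (line z t)) = q (line z t).
Proof.
have [Q [tQ mQ rQ]] := line_tile t; have [_ _ PQ] := hPsi.
have qi := tile_vdeco_inj tQ.
apply: (represents_inj qi _ (orbit_projection_represents hq tQ rQ)).
have [s [v [rv -> bv cv]]] := maps_onto_represents qi (PQ Q tQ mQ) rQ.
have [b [v' [rv' -> bv' cv']]] := belyi_represents hf rv.
exists b, v'; split=> // [j k jk|]; last by rewrite cv.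
have [l lj] := deco_surj (@vdeco_inj _ _ s) (vdeco Q j).
by rewrite (bv j l) ?(bv' l k) ?lj.
Qed.

End WithMaps.
End Development.

(** * Concatenation of consecutive pieces of a curve *)

Section Concatenation.
Variables (R : realType) (S : topologicalType).
Implicit Types (a : nat -> path_on R S).

Lemma path_concatS a r :
  path_concat a r.+2 = path_cat (path_concat a r.+1) (a r.+1).
Proof.
rewrite /path_concat (_ : iota 1 r.+2.-1 = iota 1 r ++ [:: r.+1]).
  by rewrite map_cat foldl_cat.
by rewrite -[_ ++ _]/(iota 1 r ++ iota (1 + r) 1) -iotaD addn1.
Qed.

Lemma path_concat_pieces a (c : R -> S) (T : R) : 0 < T ->
  (forall k, plen (a k) = T) ->
  (forall k t, t \in `[0, T] -> pfun (a k) t = c (k%:R * T + t)) ->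
  forall r, plen (path_concat a r.+1) = r.+1%:R * T /\
    {in `[0, r.+1%:R * T], forall t, pfun (path_concat a r.+1) t = c t}.
Proof.
move=> T0 aT ac; elim=> [|r [IHl IH]].
  rewrite /path_concat /= aT mul1r; split=> // t tT.
  by rewrite ac // mul0r add0r.
rewrite path_concatS /= IHl aT -[in RHS]natr1 mulrDl mul1r; split=> // t.
rewrite -[r.+2%:R]natr1 mulrDl mul1r in_itv /= => /andP[t0 t1].
(* At the junction itself [path_cat] takes the left path; the new piece is used only strictly
   later. *)
case: ifPn => [tr|]; first by rewrite IH // in_itv /= t0.
rewrite -ltNge => tr; rewrite ac ?in_itv /=; last by apply/andP; split; lra.
by congr c; ring.
Qed.

End Concatenation.

Theorem theorem6 (R : realType) (X : decorated_triangulation R)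
  (hX : connected [set: surface X])
  (f : surface X -> surface (double_triangle R)) (hf : belyi_function f)
  (d : nat) (hd : has_degree f d)
  (a : 'I_d -> set (surface X)) (p : 'I_d -> surface X)
  (hlab : dessin_labelling a p)
  (q : R[i] -> surface (double_triangle R)) (hq : orbit_projection q)
  (m n : int) (hmn : coprimez m n) (hn : odd `|n|%N) :
  let omega0 : R[i] := m%:~R + n%:~R * omega R in
  let ell := line omega0 in
  let gamma := q \o ell in
  let T := line_period omega0 in
  forall (sigma : {perm 'I_d})
    (hsigma : forall j, p (sigma j) = monodromy f gamma T (p j))
    (i : 'I_d) (Psi : R[i] -> surface X) (hPsi : development omega0 (p i) Psi),
  let r := #|porbit sigma i| in
  reparametrization
    (PathOn (r%:R * T) (Psi \o ell))
    (path_concat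
       (fun k => lift_from f gamma T (iter k (monodromy f gamma T) (p i))) r).
Proof.
move=> omega0 ell gamma T sigma hsigma i Psi hPsi r.
have T0 : 0 < T := line_period_gt0 _.
have hT : Hex (T%:C * omega0) := line_period_Hex R m n.
(* [gamma] avoids the three vertices, as [lift_unique] requires. *)
have cv t : t \in `[0, T] ->
    exists d, forall d', d' <> d -> 0 < descend (deco_bary d') (gamma t).
  move=> _; have [Q [tQ _ rQ]] := line_tile omega0 t.
  apply: (represents_nonvertex tQ rQ); first exact: line_Lambda.
  exact: orbit_projection_represents.
have isl k :
    is_lift f gamma T (Psi (ell (k%:R * T))) (fun t => Psi (ell (k%:R * T + t))).
  split=> [||t _]; last 2 first.
  - by rewrite addr0.
  - by rewrite (development_lifts hf hq hPsi) orbit_projection_periodic.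
  apply: continuous_subspaceT => t.
  apply: (@continuous_comp _ _ _ (fun t => k%:R * T + t) (Psi \o ell)).
    by apply: cvgD; [exact: cvg_cst|exact: cvg_id].
  exact: development_continuous hPsi _.
(* The translated restriction of the development is a lift, so [xget] chooses a genuine lift, and
   uniqueness makes the two equal on the interval. *)
have lE k : {in `[0, T], forall t,
    pfun (lift_from f gamma T (Psi (ell (k%:R * T)))) t = Psi (ell (k%:R * T + t))}.
  move=> t tT; apply: (lift_unique hf cv _ (isl k) tT).
  exact: (xgetI _ (isl k)).
(* The endpoint of each piece is the starting point of the next, so iterated monodromy follows the
   development at multiples of [T]. *)
have mE k : iter k (monodromy f gamma T) (p i) = Psi (ell (k%:R * T)).
  elim: k => [|k IH].
    by have [_ <- _] := hPsi; rewrite mul0r /ell /line mul0r addr0.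
  rewrite iterS IH /monodromy lE ?in_itv /= ?lexx ?ltW //.
  by rewrite -[in RHS]natr1 mulrDl mul1r.
(* The cycle contains [i], so there is at least one piece and [path_concat_pieces] applies with
   [r.-1]. *)
have r0 : (0 < r)%N by rewrite /r (cardD1 i) porbit_id.
have [] := path_concat_pieces T0 (fun k => erefl : plen
  (lift_from f gamma T (iter k (monodromy f gamma T) (p i))) = T) _ r.-1 (c := Psi \o ell).
  by move=> k t tT; rewrite mE lE.
rewrite (prednK r0) => pl pE; exists id; split=> //.
- by apply: continuous_subspaceT => t; exact: cvg_id.
- by move=> t tr; rewrite pE.
Qed.
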